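(* Fix $d\ge 2$ and $0\le j\le d-1$. Given an integer $s=s(n)$ between $1$ and $dn/2$, define $x=\ell_n^{-1}(s)$ and suppose that $\beta_j(n,x)\to\infty$ as $n\to\infty$. Then for $w=w(n)\to\infty$ with $w=o(\beta_j(n,x)^{1/2})$, $$\mathbf P\big(|D_j(s)-\beta_j(n,x)|\le w\,\beta_j(n,x)^{1/2}\big)=1-O(w^{-2}).$$
   Context: The $d$-process $\mathcal P(d,n)$ starts with the empty graph on $n$ vertices and at each step adds one edge chosen uniformly at random from all pairs of distinct vertices that are not yet edges and both of whose vertices currently have degree less than $d$; it stops when no such pair exists. $G_s$ denotes the graph when it has $s$ edges, and $D_i(s)$ is the number of vertices of degree $i$ in $G_s$. For natural numbers $n$ and real $x>0$, put $\mu=x/n$, $\beta_i(n,x)=n\mu^i e^{-\mu}/i!$, and $$\ell(n,x)=\frac{dn}{2}-\frac12\sum_{i=0}^{d-1}(d-i)\beta_i(n,x).$$ For fixed $n$ the function $x\mapsto\ell(n,x)$ is strictly increasing, and its inverse is denoted $\ell_n^{-1}$. Asymptotics are as $n\to\infty$ with $d$ constant. *)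

(* Defs.v *)
From HB Require Import structures.
From mathcomp Require Import all_boot all_order all_algebra.
From mathcomp Require Import all_classical all_reals all_analysis.

Set Implicit Arguments.
Unset Strict Implicit.
Unset Printing Implicit Defensive.

Import Order.TTheory GRing.Theory Num.Theory.
Import numFieldNormedType.Exports.

Local Open Scope ring_scope.

(* A graph on the vertex set 'I_n is given by its set of edges, an edge being a
   two-element set of vertices. *)
Definition graph (n : nat) := {set {set 'I_n}}.

Definition degree (n : nat) (G : graph n) (v : 'I_n) : nat :=
  #|[set e in G | v \in e]|.

Definition available (d n : nat) (G : graph n) : {set {set 'I_n}} :=
  [set e : {set 'I_n} |
    [&& #|e| == 2%N, e \notin G & [forall v in e, (degree G v < d)%N]]].

(* Transition probabilities of the d-process, as a Markov chain on graphs; a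
   graph at which the process stops is absorbing. *)
Definition dprocess_step (R : realType) (d n : nat) (G H : graph n) : R :=
  if available d G == finset.set0 then (H == G)%:R
  else \sum_(e in available d G) (H == e |: G)%SET%:R / #|available d G|%:R.

Fixpoint dprocess_law (R : realType) (d n s : nat) (H : graph n) : R :=
  if s is s'.+1 then
    \sum_(G : graph n) dprocess_law R d s' G * dprocess_step R d G H
  else (H == finset.set0)%:R.

(* The probability that the d-process reaches a graph G_s with s edges and that
   G_s satisfies A.  The condition on the number of edges excludes the runs that
   stop with fewer than s edges, for which there is no G_s. *)
Definition prob_G (R : realType) (d n s : nat) (A : graph n -> bool) : R :=
  \sum_(G : graph n | (#|G| == s) && A G) dprocess_law R d s G.

(* D_i(s) is [num_degree i G_s]. *)
Definition num_degree (n i : nat) (G : graph n) : nat :=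
  #|[set v : 'I_n | degree G v == i]|.

Definition beta (R : realType) (i n : nat) (x : R) : R :=
  let mu := x / n%:R in n%:R * mu ^+ i * expR (- mu) / (i`!)%:R.

Definition ell (R : realType) (d n : nat) (x : R) : R :=
  d%:R * n%:R / 2 - 2^-1 * \sum_(0 <= i < d) (d - i)%:R * beta i n x.

(* Main.v *)
Require Import Defs.
From HB Require Import structures.
From mathcomp Require Import all_boot all_order all_algebra.
From mathcomp Require Import all_classical all_reals all_analysis.
From mathcomp Require Import ring lra zify.

(** Suppose first that the vertices gained their edges by independent Poisson
    clocks of rate one.  At time [m = x / n] the number of vertices of degree
    [j < d] would be binomial with mean [beta j n x], and the theorem would be
    Chebyshev's inequality.  The proof shows that the process follows this model
    when it carries the following clock: a step taken while [U] vertices are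
    unsaturated lasts [2 / U] ([tick]).  As the chosen pair is nearly uniform
    among the pairs of unsaturated vertices, each of these gains an edge during
    the step with probability [2 / U + O(1 / U ^ 2)] ([incidence_near]).

    Let the clock run down from [u0], and let [phi] be a function of the degree
    that vanishes at saturated vertices.  With [u] units left, the expected sum
    of [phi] over the vertices at the end, in the Poisson model, is [stat].  It is
    nearly a martingale of the process, and its squared deviation plus twice the
    variance still to come, [stat_spread], is nearly a supermartingale: one step
    increases [potential] by a factor of at most [1 + C * tick * exp (- u / 2)]
    ([potential_step]).  The exponential makes the product of these factors
    bounded along every trajectory, so that the mean square of a deviation is at
    most a constant times the variance in the Poisson model, plus a constant
    ([prob_bad_le]).

    The reading of the clock at step [s] is random.  Deterministic is the total
    deficiency, the sum of [d - degree] over the vertices, which is [d * n - 2 * s];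
    by the choice of [x] it is the mean of the deficiency at time [m] in the
    Poisson model.  The clock is therefore started at [m + delay].  Unless the
    statistic of the deficiency deviates, the clock has not run out at step [s]
    ([expired_deviation]), and little time is left on it ([remaining_time]); then
    few vertices would still reach or leave degree [j], and the number of vertices
    of degree [j] is close to its statistic ([num_degree_near]).

    The delay must be long enough for the fluctuations of the deficiency and short
    enough not to move [beta j n x] by more than a small multiple of
    [w * sqrt (beta j n x)].  Both can be met because the variance of the
    deficiency is at most [d] times its mean, and at early times, when
    [beta (j - 1) n x] may be much larger than [beta j n x], also at most
    [2 * d ^ 2 * x] ([deficiency_variance]). *)

Set Implicit Arguments.
Unset Strict Implicit.
Unset Printing Implicit Defensive.

Import Order.TTheory GRing.Theory Num.Theory.
Import numFieldNormedType.Exports.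

Local Open Scope classical_set_scope.
Local Open Scope ring_scope.

(** * Poisson weights and smoothed test functions *)

Section Poisson.
Variable R : realType.
Implicit Types (u t : R) (k l : nat).

Definition poisson k u : R := u ^+ k * expR (- u) / k`!%:R.

Lemma fact_gt0R k : 0 < k`!%:R :> R.
Proof. by rewrite ltr0n fact_gt0. Qed.

Lemma fact_ge1R k : 1 <= k`!%:R :> R.
Proof. by rewrite ler1n fact_gt0. Qed.

Lemma poisson_ge0 k u : 0 <= u -> 0 <= poisson k u.
Proof. by move=> u0; rewrite divr_ge0 ?mulr_ge0 ?exprn_ge0 ?expR_ge0. Qed.

Lemma poisson0 u : poisson 0 u = expR (- u).
Proof. by rewrite /poisson expr0 mul1r fact0 divr1. Qed.

Lemma poisson1 u : poisson 1 u = u * expR (- u).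
Proof. by rewrite /poisson expr1 divr1. Qed.

Lemma exp_partial_sum_le N u :
  0 <= u -> \sum_(k < N) u ^+ k / k`!%:R <= expR u.
Proof.
move=> u0; rewrite -(big_mkord xpredT (fun k => u ^+ k / k`!%:R)).
have -> : \sum_(0 <= k < N) u ^+ k / k`!%:R = series (exp_coeff u) N by [].
apply: nondecreasing_cvgn_le; last exact: is_cvg_series_exp_coeff.
by apply: nondecreasing_series => n _ _; exact: exp_coeff_ge0.
Qed.

Lemma poisson_sum_le1 N u : 0 <= u -> \sum_(k < N) poisson k u <= 1.
Proof.
move=> u0; rewrite (eq_bigr (fun k : 'I_N => u ^+ k / k`!%:R * expR (- u)));
  last by move=> k _; rewrite /poisson mulrAC.
by rewrite -mulr_suml expRN ler_pdivrMr ?expR_gt0// mul1r exp_partial_sum_le.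
Qed.

Lemma poisson_le1 k u : 0 <= u -> poisson k u <= 1.
Proof.
move=> u0; apply: le_trans (poisson_sum_le1 k.+1 u0).
by rewrite big_ord_recr /= lerDr sumr_ge0// => i _; exact: poisson_ge0.
Qed.

Lemma poisson_le_exp k u : 0 <= u -> poisson k u <= u ^+ k.
Proof.
move=> u0; rewrite /poisson -mulrA ler_piMr ?exprn_ge0//.
by rewrite ler_pdivrMr ?fact_gt0R// mul1r (le_trans _ (fact_ge1R k))// expR_le1 oppr_le0.
Qed.

(** Half of the exponential decay absorbs the power of [u], which leaves a bound
    that is summable along the trajectory of the clock. *)
Lemma poisson_decay k u : 0 <= u -> poisson k u <= 2 ^+ k * expR (- (u / 2)).
Proof.
move=> u0; have u20 : 0 <= u / 2 by rewrite divr_ge0.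
have -> : poisson k u = 2 ^+ k * poisson k (u / 2) * expR (- (u / 2)).
  rewrite /poisson [in LHS](splitr u) opprD expRD -(splitr u) expr_div_n.
  by field; rewrite ?expf_neq0 ?gt_eqF ?fact_gt0R.
by rewrite ler_wpM2r ?expR_ge0// ler_piMr ?exprn_ge0// poisson_le1.
Qed.

(** Poisson variables add up: this is the semigroup property of the clock. *)
Lemma poissonD k u t :
  poisson k (u + t) = \sum_(l < k.+1) poisson l t * poisson (k - l) u.
Proof.
rewrite /poisson exprDn opprD expRD 2!mulr_suml; apply: eq_bigr => -[l] /=.
rewrite ltnS => lk _; rewrite -mulr_natr -(bin_fact lk) !natrM.
field; rewrite !gt_eqF ?fact_gt0R ?ltr0n ?bin_gt0//.
Qed.

Lemma triangular_sumE (N : nat) (F : nat -> nat -> R) :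
    (forall l m, (N <= l + m)%N -> F l m = 0) ->
  \sum_(k < N) \sum_(l < k.+1) F l (k - l)%N = \sum_(l < N) \sum_(m < N) F l m.
Proof.
move=> F0.
transitivity (\sum_(0 <= k < N) \sum_(0 <= l < N | (l <= k)%N) F l (k - l)%N).
  rewrite big_mkord; apply: eq_bigr => k _.
  rewrite big_mkord (big_ord_widen N (fun l => F l (k - l)%N)) ?ltn_ord//.
rewrite (exchange_big_dep_nat xpredT)//= big_mkord; apply: eq_bigr => l _.
rewrite -(big_nat_widenl l 0 N xpredT (fun k => F l (k - l)%N))//.
rewrite -{1}[l : nat]add0n big_addn.
rewrite -(big_mkord xpredT (fun m => F l m)).
rewrite [RHS](big_cat_nat (n := (N - l)%N))//= ?leq_subr//.
rewrite [X in _ + X]big_nat_cond [X in _ + X]big1 ?addr0; last first.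
  by move=> m /andP[/andP[lm _] _]; rewrite F0// -leq_subLR.
by apply: eq_bigr => m _; rewrite addnK.
Qed.

(** The expected value of [phi] at a vertex that now has degree [i] and gains a
    Poisson number of edges of mean [u].  The sum stops at [d] because it is
    applied to functions that vanish from [d] on. *)
Definition smooth d (phi : nat -> R) i u : R :=
  \sum_(k < d) poisson k u * phi (i + k)%N.

(** The variance of the same random value. *)
Definition spread d (phi : nat -> R) i u : R :=
  smooth d (fun k => phi k ^+ 2) i u - smooth d phi i u ^+ 2.

(** Vanishing from [d] on encodes saturation: a vertex may overshoot degree [d]
    on the Poisson clock without any effect on a statistic built from [phi]. *)
Definition test_fun d (B : R) (phi : nat -> R) :=
  (forall i, 0 <= phi i <= B) /\ (forall i, (d <= i)%N -> phi i = 0).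

Lemma test_fun_sqr d B phi :
  test_fun d B phi -> test_fun d (B ^+ 2) (fun k => phi k ^+ 2).
Proof.
move=> [phiB phi0]; split=> i; last by move=> /phi0 ->; rewrite expr0n.
by have /andP[p0 pB] := phiB i; rewrite sqr_ge0 lerXn2r// nnegrE// (le_trans p0).
Qed.

Section Smooth.
Variables (d : nat) (B : R) (phi : nat -> R).
Hypothesis phi_test : test_fun d B phi.

Lemma smooth_ge0 i u : 0 <= u -> 0 <= smooth d phi i u.
Proof.
move=> u0; apply: sumr_ge0 => k _; rewrite mulr_ge0 ?poisson_ge0//.
by have /andP[] := phi_test.1 (i + k)%N.
Qed.

Lemma smooth_le i u : 0 <= u -> smooth d phi i u <= B.
Proof.
move=> u0; have B0 : 0 <= B by have /andP[a b] := phi_test.1 0%N; exact: le_trans b.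
apply: (@le_trans _ _ (\sum_(k < d) poisson k u * B)).
  apply: ler_sum => k _; rewrite ler_wpM2l ?poisson_ge0//.
  by have /andP[] := phi_test.1 (i + k)%N.
by rewrite -mulr_suml ler_piMl// poisson_sum_le1.
Qed.

Lemma smooth_decay i u :
  0 <= u -> smooth d phi i u <= B * (d%:R * 2 ^+ d) * expR (- (u / 2)).
Proof.
move=> u0; have B0 : 0 <= B by have /andP[a b] := phi_test.1 0%N; exact: le_trans b.
apply: (@le_trans _ _ (\sum_(k < d) (2 ^+ d * expR (- (u / 2))) * B)); last first.
  by rewrite sumr_const card_ord -mulr_natl le_eqVlt; apply/orP; left; apply/eqP; ring.
apply: ler_sum => k _; have /andP[p0 pB] := phi_test.1 (i + k)%N.
apply: ler_pM => //; first exact: poisson_ge0.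
apply: le_trans (poisson_decay k u0) _; rewrite ler_wpM2r ?expR_ge0//.
by rewrite ler_weXn2l ?ler1n// ltnW.
Qed.

Lemma smooth_eq0 i u : (d <= i)%N -> smooth d phi i u = 0.
Proof.
move=> di; apply: big1 => k _.
by rewrite (phi_test.2 (i + k)%N) ?mulr0// (leq_trans di)// leq_addr.
Qed.

(** Waiting [t] and then [u] is waiting [u + t]; the terms that the truncation
    drops are zero. *)
Lemma smoothD i u t :
  smooth d phi i (u + t) = \sum_(l < d) poisson l t * smooth d phi (i + l) u.
Proof.
pose F l m := poisson l t * poisson m u * phi (i + l + m)%N.
transitivity (\sum_(k < d) \sum_(l < k.+1) F l (k - l)%N).
  apply: eq_bigr => k _; rewrite poissonD mulr_suml; apply: eq_bigr => -[l] /=.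
  by rewrite ltnS => lk _; rewrite /F -addnA subnKC.
rewrite triangular_sumE; first by apply: eq_bigr => l _; rewrite mulr_sumr;
  apply: eq_bigr => m _; rewrite mulrA.
move=> l m dlm; rewrite /F (phi_test.2 _) ?mulr0//.
by rewrite -addnA (leq_trans dlm)// leq_addl.
Qed.

(** During a short time [t] a Poisson clock rings once with probability
    [t + O(t ^ 2)] and more than once with probability [O(t ^ 2)].  The error is
    relative to the size [M] of [smooth] at the later time, so that it inherits
    the exponential decay of [smooth_decay]. *)
Lemma smooth_taylor M i u t : (2 <= d)%N -> 0 <= u -> 0 <= t -> t <= 1 ->
    (forall k, smooth d phi k u <= M) ->
  `|smooth d phi i (u + t)
    - (smooth d phi i u + t * (smooth d phi i.+1 u - smooth d phi i u))|
  <= (d%:R + 2) * t ^+ 2 * M.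
Proof.
move=> d2 u0 t0 t1 gM; pose g k := smooth d phi k u.
have g0 k : 0 <= g k by exact: smooth_ge0.
rewrite smoothD -(big_mkord xpredT (fun l => poisson l t * g (i + l)%N)).
rewrite big_ltn ?(ltn_trans _ d2)// big_ltn// addn0 addn1 poisson0 poisson1.
set S := \sum_(2 <= l < d) _; rewrite -/(g i) -/(g i.+1).
have S0 : 0 <= S by apply: sumr_ge0 => l _; rewrite mulr_ge0 ?poisson_ge0.
have SM : S <= d%:R * t ^+ 2 * M.
  apply: (@le_trans _ _ (\sum_(2 <= l < d) t ^+ 2 * M)).
    apply: ler_sum_nat => l /andP[l2 _].
    apply: ler_pM => //; [exact: poisson_ge0| |exact: gM].
    apply: le_trans (poisson_le_exp l t0) _.
    by rewrite -(subnK l2) exprD ler_piMl ?exprn_ge0// exprn_ile1.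
  rewrite sumr_const_nat -[leLHS]mulr_natl mulrA ler_wpM2r ?(le_trans (g0 0%N) (gM 0%N))//.
  by rewrite ler_wpM2r ?exprn_ge0// ler_nat leq_subr.
have e1 : 1 - t <= expR (- t) by rewrite (le_trans _ (expR_ge1Dx _)).
have e2 : expR (- t) <= 1 - t + t ^+ 2.
  rewrite expRN -[leLHS]mul1r ler_pdivrMr ?expR_gt0//.
  have q0 : 0 <= 1 - t + t ^+ 2 by nra.
  apply: (@le_trans _ _ ((1 - t + t ^+ 2) * (1 + t))); first by nra.
  by rewrite ler_wpM2l// expR_ge1Dx.
have M0 := le_trans (g0 0%N) (gM 0%N).
have gi := g0 i; have gi1 := g0 i.+1; have gMi := gM i; have gMi1 := gM i.+1.
rewrite -/(g i) in gMi; rewrite -/(g i.+1) in gMi1.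
set E := expR (- t) in e1 e2 *.
have h1 : 0 <= (E - (1 - t)) * g i <= t ^+ 2 * M by apply/andP; split; nra.
have h2 : 0 <= t * (1 - E) * g i.+1 <= t ^+ 2 * M.
  apply/andP; split; first by rewrite !mulr_ge0// subr_ge0 expR_le1 oppr_le0.
  by apply: ler_pM => //; [rewrite mulr_ge0// subr_ge0 expR_le1 oppr_le0|rewrite expr2 ler_wpM2l//; lra].
have -> : E * g i + (t * E * g i.+1 + S) - (g i + t * (g i.+1 - g i)) =
  (E - (1 - t)) * g i - t * (1 - E) * g i.+1 + S by ring.
case/andP: h1 => h1 h1'; case/andP: h2 => h2 h2'.
have tM : 0 <= t ^+ 2 * M by rewrite mulr_ge0 ?exprn_ge0.
have -> : (d%:R + 2) * t ^+ 2 * M = d%:R * t ^+ 2 * M + 2 * (t ^+ 2 * M) by ring.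
by rewrite ler_norml; apply/andP; split; lra.
Qed.

End Smooth.

Section Spread.
Variables (d : nat) (B : R) (phi : nat -> R).
Hypothesis phi_test : test_fun d B phi.

(** The Cauchy-Schwarz inequality, for weights whose sum is at most one. *)
Lemma spread_ge0 i u : 0 <= u -> 0 <= spread d phi i u.
Proof.
move=> u0; rewrite /spread; set g := smooth d phi i u.
apply: (@le_trans _ _ (\sum_(k < d) poisson k u * (phi (i + k)%N - g) ^+ 2)).
  by apply: sumr_ge0 => k _; rewrite mulr_ge0 ?sqr_ge0 ?poisson_ge0.
rewrite (eq_bigr (fun k : 'I_d => poisson k u * phi (i + k)%N ^+ 2
  - 2 * g * (poisson k u * phi (i + k)%N) + g ^+ 2 * poisson k u)); last first.
  by move=> k _; ring.
rewrite big_split sumrB -!mulr_sumr /= -/(smooth d phi i u) -/g.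
rewrite -/(smooth d (fun k => phi k ^+ 2) i u).
have := poisson_sum_le1 d u0; have := sqr_ge0 g; set s := \sum_(_ < d) _; nra.
Qed.

Lemma spread_eq0 i u : (d <= i)%N -> spread d phi i u = 0.
Proof.
move=> di; rewrite /spread (smooth_eq0 phi_test)//.
by rewrite (smooth_eq0 (test_fun_sqr phi_test))// expr0n subr0.
Qed.

Lemma spread_le i u : spread d phi i u <= smooth d (fun k => phi k ^+ 2) i u.
Proof. by rewrite lerBlDr lerDl sqr_ge0. Qed.

(** The variance still to come decreases by the squared jump of the conditional
    mean [smooth]: this is the decomposition of a variance over a short time, and
    it is what allows the spread to pay for the growth of a squared deviation. *)
Lemma spread_taylor M i u t : (2 <= d)%N -> 0 <= u -> 0 <= t -> t <= 1 ->
    (forall k, smooth d phi k u <= M) ->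
    (forall k, smooth d (fun k => phi k ^+ 2) k u <= M) ->
  `|spread d phi i (u + t)
    - (spread d phi i u + t * (spread d phi i.+1 u - spread d phi i u)
       + t * (smooth d phi i.+1 u - smooth d phi i u) ^+ 2)|
  <= (d%:R + 2) * (1 + 3 * B) * t ^+ 2 * M.
Proof.
move=> d2 u0 t0 t1 gM hM.
have := smooth_taylor (test_fun_sqr phi_test) i d2 u0 t0 t1 hM.
have := smooth_taylor phi_test i d2 u0 t0 t1 gM.
have ut0 : 0 <= u + t by rewrite addr_ge0.
have M0 : 0 <= M by apply: le_trans (gM 0%N); exact: smooth_ge0 phi_test _ _ u0.
have a0 := smooth_ge0 phi_test i u0; have aB := smooth_le phi_test i u0.
have b0 := smooth_ge0 phi_test i.+1 u0; have bB := smooth_le phi_test i.+1 u0.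
have c0 := smooth_ge0 phi_test i ut0; have cB := smooth_le phi_test i ut0.
have aM := gM i; have bM := gM i.+1.
rewrite /spread.
move: (smooth d phi i u) (smooth d phi i.+1 u) (smooth d phi i (u + t))
  a0 aB b0 bB c0 cB aM bM => a b c a0 aB b0 bB c0 cB aM bM.
move: (smooth d _ i u) (smooth d _ i.+1 u) (smooth d _ i (u + t)) => a2 b2 c2.
have B0 : 0 <= B := le_trans a0 aB.
set K := d%:R + 2 => he he2.
have K1 : 1 <= K by rewrite /K; have := ler0n R d; lra.
set e := c - (a + t * (b - a)) in he.
set e2 := c2 - (a2 + t * (b2 - a2)) in he2.
have -> : c2 - c ^+ 2 - (a2 - a ^+ 2 + t * (b2 - b ^+ 2 - (a2 - a ^+ 2))
   + t * (b - a) ^+ 2) = e2 - e * (c + (a + t * (b - a))) - t ^+ 2 * (b - a) ^+ 2.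
  by rewrite /e /e2; ring.
have s2 : `|e * (c + (a + t * (b - a)))| <= K * t ^+ 2 * M * (2 * B).
  rewrite normrM; apply: ler_pM => //.
  by rewrite ler_norml; apply/andP; split; nra.
have s3 : `|t ^+ 2 * (b - a) ^+ 2| <= t ^+ 2 * (K * M * B).
  rewrite normrM ger0_norm ?exprn_ge0// ler_wpM2l ?exprn_ge0//.
  rewrite ger0_norm ?sqr_ge0//.
  have : (b - a) ^+ 2 <= M * B.
    by rewrite -real_normK ?num_real// expr2 ler_pM// ler_norml; apply/andP; split; lra.
  by move=> /le_trans; apply; rewrite -mulrA ler_peMl// mulr_ge0.
have -> : K * (1 + 3 * B) * t ^+ 2 * M = K * t ^+ 2 * M + K * t ^+ 2 * M * (2 * B)
  + t ^+ 2 * (K * M * B) by ring.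
apply: le_trans (ler_normB _ _) _; apply: lerD => //.
by apply: le_trans (ler_normB _ _) _; apply: lerD.
Qed.

End Spread.
End Poisson.

(** * Degrees and available pairs *)

Section Graph.
Variables (d n : nat).
Implicit Types (G H : graph n) (v w : 'I_n) (e : {set 'I_n}).

(** An invariant of the process, under which the degrees add up to twice the
    number of edges. *)
Definition admissible G :=
  (forall e, e \in G -> #|e| = 2%N) /\ (forall v, (degree G v <= d)%N).

Definition unsat G : {set 'I_n} := [set v | (degree G v < d)%N]%SET.

Lemma admissible0 : admissible finset.set0.
Proof.
split=> [e|v]; first by rewrite inE.
by rewrite /degree (_ : [set e in _ | _]%SET = finset.set0) ?cards0//;
  apply/setP => e; rewrite !inE.
Qed.

Lemma degree0 v : degree (finset.set0 : graph n) v = 0%N.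
Proof.
by rewrite /degree (_ : [set e in _ | _]%SET = finset.set0) ?cards0//;
  apply/setP => e; rewrite !inE.
Qed.

Lemma degreeU1 G e v : e \notin G -> degree (e |: G)%SET v = (degree G v + (v \in e))%N.
Proof.
move=> eG; rewrite /degree; case: (boolP (v \in e)) => ve.
  rewrite addn1 (_ : [set f in (e |: G)%SET | v \in f]%SET =
    (e |: [set f in G | v \in f])%SET).
    by rewrite cardsU1 !inE (negPf eG).
  by apply/setP => f; rewrite !inE; case: eqVneq => //= ->; rewrite ve.
rewrite addn0; congr #|pred_of_set _|; apply/setP => f; rewrite !inE.
by case: eqVneq => //= ->; rewrite (negPf ve) andbF.
Qed.

Lemma availableP G e : e \in available d G ->
  [/\ #|e| = 2%N, e \notin G & forall v, v \in e -> v \in unsat G].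
Proof.
rewrite inE => /and3P[/eqP e2 eG /forall_inP eU]; split=> // v /eU.
by rewrite inE.
Qed.

Lemma admissibleU1 G e : admissible G -> e \in available d G -> admissible (e |: G)%SET.
Proof.
move=> [G2 Gd] /availableP[e2 eG eU]; split=> [f|v].
  by rewrite in_setU1 => /orP[/eqP ->|/G2].
rewrite degreeU1//; case: (boolP (v \in e)) => [/eU|]; last by rewrite addn0.
by rewrite inE addn1.
Qed.

Lemma sum_degree G : admissible G -> (\sum_v degree G v = 2 * #|G|)%N.
Proof.
move=> [G2 _]; transitivity (\sum_v \sum_(e in G) (v \in e))%N.
  apply: eq_bigr => v _; rewrite /degree -sum1_card big_mkcond [RHS]big_mkcond.
  by apply: eq_bigr => e _; rewrite !inE; case: (e \in G); case: (v \in e).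
rewrite exchange_big /= (eq_bigr (fun=> 2%N)); first by rewrite sum_nat_const mulnC.
by move=> e /G2 <-; rewrite -sum1_card [RHS]big_mkcond; apply: eq_bigr => v _; case: (v \in e).
Qed.

Lemma degree_sat G v : admissible G -> v \notin unsat G -> degree G v = d.
Proof.
move=> [_ Gd]; rewrite inE -leqNgt => dv; apply/eqP.
by rewrite eqn_leq Gd.
Qed.

(** The total deficiency is a function of the number of edges alone; it is the
    deterministic quantity against which the random clock is measured. *)
Lemma deficiencyE G : admissible G ->
  ((\sum_v (d - degree G v)) + 2 * #|G| = d * n)%N.
Proof.
move=> Gadm; rewrite -(sum_degree Gadm) -big_split /=.
rewrite (eq_bigr (fun=> d)); first by rewrite sum_nat_const card_ord mulnC.
by move=> v _; rewrite subnK//; case: Gadm.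
Qed.

Lemma deficiency_le_unsat G : admissible G ->
  (d * n <= d * #|unsat G| + 2 * #|G|)%N.
Proof.
move=> Gadm; rewrite -(deficiencyE Gadm) leq_add2r.
rewrite (bigID (fun v => v \in unsat G)) /= [X in (_ + X)%N]big1.
  rewrite addn0 mulnC -sum_nat_const; apply: leq_sum => v _; exact: leq_subr.
by move=> v /(degree_sat Gadm) ->; rewrite subnn.
Qed.

Lemma set2_inj v : injective (fun w => [set v; w]%SET).
Proof.
move=> w w' /setP eq; have := eq w; have := eq w'; rewrite !inE !eqxx !orbT.
by case: (eqVneq w' v) => [->|_] /=; [case: eqVneq => //= _ _ /esym/eqP|move=> /eqP].
Qed.

(** A fixed unsaturated vertex can be joined to any other unsaturated vertex
    except its fewer than [d] neighbours, so that the chosen pair is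
    nearly uniform. *)
Lemma card_available_at G v : v \in unsat G ->
  (#|unsat G| <= #|[set e in available d G | v \in e]| + d)%N /\
  (#|[set e in available d G | v \in e]| < #|unsat G|)%N.
Proof.
move=> vU; set A := [set e in _ | _]%SET; pose W := (unsat G :\ v)%SET.
have cW : (#|W|.+1 = #|unsat G|)%N by rewrite (cardsD1 v (unsat G)) vU.
pose W1 := [set w in W | [set v; w]%SET \in G]%SET.
pose W0 := [set w in W | [set v; w]%SET \notin G]%SET.
have cW01 : (#|W0| + #|W1| = #|W|)%N.
  rewrite addnC -(cardsID [set w | [set v; w]%SET \in G]%SET W).
  by congr (_ + _)%N; apply: eq_card => w; rewrite !inE// andbC.
have AE : A = [set [set v; w]%SET | w in W0]%SET.
  apply/setP => e; apply/idP/imsetP => [|[w + ->]].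
    rewrite inE => /andP[/availableP[/eqP/cards2P[a [b [ab ->]]] eG eU]].
    have aU := eU a; have bU := eU b; rewrite !inE !eqxx orbT /= in aU bU.
    rewrite !inE => /orP[] /eqP vE.
      by exists b; rewrite ?vE// /W0 /W !inE vE eG eq_sym ab (bU isT).
    exists a; last by rewrite vE finset.setUC.
    by rewrite /W0 /W !inE vE ab (aU isT) finset.setUC eG.
  rewrite /W0 /W !inE => /andP[/andP[wv wU] vw].
  rewrite cards2 [v == w]eq_sym wv vw eqxx andbT /=.
  apply/forall_inP => x; rewrite !inE => /orP[] /eqP -> //.
  by move: vU; rewrite inE.
have cA : (#|A| = #|W0|)%N by rewrite AE card_imset//; exact: set2_inj.
have cW1 : (#|W1| < d)%N.
  move: vU; rewrite inE; apply: leq_ltn_trans.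
  rewrite -(card_imset W1 (@set2_inj v)); apply: subset_leq_card.
  by apply/fintype.subsetP => e /imsetP[w]; rewrite !inE => /andP[_ ? ->]; rewrite !inE eqxx andbT.
by rewrite cA; split; rewrite -cW -cW01; [rewrite -addnS leq_add2l|rewrite ltnS leq_addr].
Qed.

Lemma available_at_sat G v : v \notin unsat G ->
  #|[set e in available d G | v \in e]%SET| = 0%N.
Proof.
move=> vU; apply/eqP; rewrite cards_eq0; apply/eqP/setP => e; rewrite [in RHS]inE.
apply/negP; rewrite inE => /andP[/availableP[_ _ eU] /eU]; exact/negP.
Qed.

Lemma sum_available_at G :
  (\sum_v #|[set e in available d G | v \in e]%SET| = 2 * #|available d G|)%N.
Proof.
transitivity (\sum_v \sum_(e in available d G) (v \in e))%N.
  apply: eq_bigr => v _; rewrite -sum1_card big_mkcond [RHS]big_mkcond.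
  apply: eq_bigr => e _; rewrite [e \in finset _]inE.
  by case: (e \in available _ _); case: (v \in e).
rewrite exchange_big /= (eq_bigr (fun=> 2%N)); first by rewrite sum_nat_const mulnC.
by move=> e /availableP[<- _ _]; rewrite -sum1_card [RHS]big_mkcond; apply: eq_bigr => v _; case: (v \in e).
Qed.

Lemma card_available G :
  (#|unsat G| * (#|unsat G| - d) <= 2 * #|available d G|)%N /\
  (2 * #|available d G| <= #|unsat G| * (#|unsat G| - 1))%N.
Proof.
rewrite -sum_available_at (bigID (fun v => v \in unsat G)) /= [X in (_ + X)%N]big1.
  rewrite addn0; split; rewrite -sum_nat_const; apply: leq_sum => v /card_available_at[].
    by rewrite leq_subLR addnC.
  by move=> _; case: #|unsat G| => // k; rewrite subn1.
by move=> v; exact: available_at_sat.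
Qed.

End Graph.

(** * The transition operator and the clock *)

Section Step.
Variables (R : realType) (d n : nat).
Implicit Types (G H : graph n) (v : 'I_n) (e : {set 'I_n}) (F : graph n -> R).

Definition step_exp F G : R := \sum_H dprocess_step R d G H * F H.

Lemma step_expE F G : available d G != finset.set0 ->
  step_exp F G = (\sum_(e in available d G) F (e |: G)%SET) / #|available d G|%:R.
Proof.
move=> /negPf A0; rewrite /step_exp /dprocess_step A0.
under eq_bigr do rewrite mulr_suml.
rewrite exchange_big /= mulr_suml; apply: eq_bigr => e _.
rewrite (bigD1 (e |: G)%SET)//= eqxx big1 ?addr0; first by rewrite mul1r mulrC.
by move=> H /negPf ->; rewrite !mul0r.
Qed.

Lemma step_exp_stuck F G : available d G == finset.set0 -> step_exp F G = F G.
Proof.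
move=> A0; rewrite /step_exp /dprocess_step A0 (bigD1 G)//= eqxx mul1r big1 ?addr0//.
by move=> H /negPf ->; rewrite mul0r.
Qed.

Lemma dprocess_step_ge0 G H : 0 <= dprocess_step R d G H.
Proof. by rewrite /dprocess_step; case: ifP => // _; apply: sumr_ge0 => e _; rewrite divr_ge0. Qed.

Lemma step_exp_le F F' G : (forall H, F H <= F' H) -> step_exp F G <= step_exp F' G.
Proof. by move=> FF; apply: ler_sum => H _; rewrite ler_wpM2l// dprocess_step_ge0. Qed.

Lemma card_avail_gt0 G : available d G != finset.set0 -> 0 < #|available d G|%:R :> R.
Proof. by move=> A0; rewrite ltr0n card_gt0. Qed.

Lemma step_exp_cst c G : step_exp (fun=> c) G = c.
Proof.
have [A0|A0] := eqVneq (available d G) finset.set0; first by rewrite step_exp_stuck// A0.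
rewrite step_expE// sumr_const -[_ *+ #|_|]mulr_natr mulfK//.
by rewrite gt_eqF// card_avail_gt0.
Qed.

Lemma iter_step_exp_cst c k G : iter k step_exp (fun=> c) G = c.
Proof.
elim: k G => //= k IH G; rewrite -[RHS](step_exp_cst c G).
by congr step_exp; apply/funext => H; rewrite IH.
Qed.

Lemma iter_step_exp_le F F' k G : (forall H, F H <= F' H) ->
  iter k step_exp F G <= iter k step_exp F' G.
Proof. by move=> FF; elim: k G => //= k IH G; exact: step_exp_le. Qed.

Lemma dprocess_lawE s F :
  \sum_G dprocess_law R d s G * F G = iter s step_exp F finset.set0.
Proof.
elim: s F => [|s IH] F /=.
  rewrite (bigD1 finset.set0)//= eqxx mul1r big1 ?addr0//.
  by move=> G /negPf ->; rewrite mul0r.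
rewrite -iterS iterSr -IH.
under eq_bigr do rewrite mulr_suml.
rewrite exchange_big /=; apply: eq_bigr => G _; rewrite mulr_sumr.
by apply: eq_bigr => H _; rewrite mulrA.
Qed.

(** The process loses no mass, so that bounding from below the probability of a
    good graph amounts to bounding from above the expectation of an indicator,
    which also charges the runs that stop before [s] edges. *)
Lemma prob_GE s A : prob_G R d s A =
  1 - iter s step_exp (fun G : graph n => (~~ ((#|G| == s) && A G))%:R) finset.set0.
Proof.
rewrite -[X in X - _](iter_step_exp_cst 1 s finset.set0) -!dprocess_lawE.
rewrite -sumrB /prob_G big_mkcond; apply: eq_bigr => G _; rewrite -mulrBr.
by case: (_ && _); rewrite /= ?subr0 ?subrr ?mulr1 ?mulr0.
Qed.

(** The clock: a step taken with [U] unsaturated vertices lasts [2 / U], so that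
    every unsaturated vertex gains degree at rate one up to [O(1 / U)]. *)
Definition tick G : R := 2 / #|unsat d G|%:R.

Section Average.
Variable G : graph n.
Hypothesis d2 : (2 <= d)%N.
Hypothesis Ubig : (2 * d <= #|unsat d G|)%N.

Local Notation A := (available d G).
Local Notation U := (#|unsat d G|%:R : R).
Local Notation t := (tick G).

Lemma unsat_gt0 : 0 < U.
Proof. by rewrite ltr0n (leq_trans _ Ubig)// muln_gt0/= (ltn_trans _ d2). Qed.

Lemma unsat_ge : 2 * d%:R <= U.
Proof. by rewrite -natrM ler_nat. Qed.

Lemma d_ge2 : 2 <= d%:R :> R.
Proof. by rewrite ler_nat. Qed.

Lemma avail_bounds : U * (U - d%:R) <= 2 * #|A|%:R /\ 2 * #|A|%:R <= U * (U - 1).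
Proof.
have [h1 h2] := card_available d G.
have dU : (d <= #|unsat d G|)%N by rewrite (leq_trans _ Ubig)// leq_pmull.
split; first by rewrite -natrB// -!natrM ler_nat.
by rewrite -[1]/(1%:R) -natrB ?(leq_trans _ dU) 1?ltnW// -!natrM ler_nat.
Qed.

Lemma avail_neq0 : available d G != finset.set0.
Proof.
rewrite -card_gt0 -(ltr0n R); have [h _] := avail_bounds.
by have := unsat_gt0; have := unsat_ge; have := d_ge2; nra.
Qed.

Lemma tick_gt0 : 0 < t. Proof. by rewrite divr_gt0// unsat_gt0. Qed.

Lemma tickU : U * t = 2.
Proof. by rewrite /tick mulrCA divff ?mulr1// gt_eqF// unsat_gt0. Qed.

Lemma tick_le1 : t <= 1.
Proof. by rewrite ler_pdivrMr ?unsat_gt0// mul1r; have := unsat_ge; have := d_ge2; lra. Qed.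

Definition avg (h : {set 'I_n} -> R) : R := (\sum_(e in A) h e) / #|A|%:R.

Lemma avg_le h h' : (forall e, e \in A -> h e <= h' e) -> avg h <= avg h'.
Proof. by move=> hh; rewrite ler_pM2r ?invr_gt0 ?card_avail_gt0 ?avail_neq0// ler_sum. Qed.

Lemma avgD h h' : avg (fun e => h e + h' e) = avg h + avg h'.
Proof. by rewrite /avg big_split mulrDl. Qed.

Lemma avgZ c h : avg (fun e => c * h e) = c * avg h.
Proof. by rewrite /avg -mulr_sumr mulrA. Qed.

Lemma avg_cst c : avg (fun=> c) = c.
Proof. by rewrite -[RHS](step_exp_cst c G) step_expE// avail_neq0. Qed.

Definition incidence v : R := #|[set e in A | v \in e]%SET|%:R / #|A|%:R.

Lemma avg_incident (y : 'I_n -> R) :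
  avg (fun e => \sum_(v in e) y v) = \sum_(v in unsat d G) incidence v * y v.
Proof.
rewrite /avg (exchange_big_dep xpredT)//= mulr_suml.
rewrite [LHS](bigID (fun v => v \in unsat d G)) /= [X in _ + X]big1 ?addr0.
  apply: eq_bigr => v _; rewrite sumr_const -[y v *+ _]mulr_natl /incidence mulrAC.
  by congr (_ / _ * _); congr (_%:R); apply: eq_card => e; rewrite [RHS]inE.
move=> v vU; rewrite big1 ?mul0r// => e /andP[/availableP[_ _ eU] /eU vU'].
by rewrite vU' in vU.
Qed.

(** Both the number of pairs at a vertex and the total number of pairs are known
    up to a factor [1 + O(d / U)]. *)
Lemma incidence_near v : v \in unsat d G -> `|incidence v - t| <= d%:R * t ^+ 2.
Proof.
move=> vU; have [c1 c2] := card_available_at vU; rewrite /incidence.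
have [a1 a2] := avail_bounds; have U0 := unsat_gt0; have Ud := unsat_ge.
have a0 := card_avail_gt0 avail_neq0; have dd := d_ge2.
move: c1 c2; rewrite -(ler_nat R) natrD -(ltr_nat R) => c1 c2.
have c2' : #|[set e in A | v \in e]%SET|%:R <= U - 1.
  by rewrite lerBrDr -[1]/(1%:R) -natrD ler_nat addn1; move: c2; rewrite ltr_nat.
move: (#|[set _ in _ | _]%SET|%:R) c1 c2 c2' => c c1 c2 c2'.
have tE : t = 2 / U by []; move: (#|A|%:R) a1 a2 a0 => a a1 a2 a0.
have -> : c / a - t = (c - t * a) / a by field; rewrite gt_eqF.
rewrite normrM [`|a^-1|]gtr0_norm ?invr_gt0// ler_pdivrMr//.
rewrite ler_norml; apply/andP; split.
  have h : a * (t - d%:R * t ^+ 2) <= U * (U - 1) / 2 * (t - d%:R * t ^+ 2).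
    rewrite ler_wpM2r//; last by lra.
    have -> : t - d%:R * t ^+ 2 = t * (U - 2 * d%:R) / U.
      by rewrite tE; field; rewrite gt_eqF.
    by rewrite divr_ge0 ?(ltW U0)// mulr_ge0 ?(ltW tick_gt0)// subr_ge0.
  have h2 : U * (U - 1) / 2 * (t - d%:R * t ^+ 2) = (U - 1) - 2 * d%:R * (1 - U^-1).
    by rewrite tE; field; rewrite gt_eqF.
  have : U^-1 <= 1 / 2.
    by rewrite -[leLHS]mul1r ler_pdivrMr//; lra.
  nra.
have h : U * (U - d%:R) / 2 * (t + d%:R * t ^+ 2) <= a * (t + d%:R * t ^+ 2).
  rewrite ler_wpM2r//; last by lra.
  by rewrite addr_ge0 ?mulr_ge0 ?exprn_ge0 ?(ltW tick_gt0)//.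
have h2 : U * (U - d%:R) / 2 * (t + d%:R * t ^+ 2) = (U - d%:R) + 2 * d%:R * (1 - d%:R / U).
  by rewrite tE; field; rewrite gt_eqF.
have : d%:R / U <= 1 / 2 by rewrite ler_pdivrMr//; lra.
nra.
Qed.

Lemma avg_incident_near (y : 'I_n -> R) b :
    (forall v, v \in unsat d G -> `|y v| <= b) ->
  `|avg (fun e => \sum_(v in e) y v) - t * \sum_(v in unsat d G) y v|
    <= 2 * d%:R * t * b.
Proof.
move=> yb; rewrite avg_incident mulr_sumr -sumrB.
apply: le_trans (ler_norm_sum _ _ _) _.
apply: (@le_trans _ _ (\sum_(v in unsat d G) d%:R * t ^+ 2 * b)).
  apply: ler_sum => v vU; rewrite -mulrBl normrM.
  by apply: ler_pM => //; [exact: incidence_near|exact: yb].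
rewrite sumr_const -[leLHS]mulr_natl.
have -> : U * (d%:R * t ^+ 2 * b) = (U * t) * (d%:R * t * b) by ring.
by rewrite tickU le_eqVlt; apply/orP; left; apply/eqP; ring.
Qed.

End Average.
End Step.

(** * The potential along one step *)

Section Lyapunov.
Variables (R : realType) (d : nat).
Hypothesis d2 : (2 <= d)%N.

(** The conditional expectation, given the graph, of the sum of [phi] over the
    degrees after [u] further units of independent Poisson clocks. *)
Definition stat n phi (G : graph n) (u : R) : R :=
  \sum_(v : 'I_n) smooth d phi (degree G v) u.

Definition stat_spread n phi (G : graph n) (u : R) : R :=
  \sum_(v : 'I_n) spread d phi (degree G v) u.

(** The squared deviation of the statistic, plus twice the variance to come.  The
    factor two is the loss in [sqr_sum_pair], where the two ends of the chosen
    edge are treated as if they were fully correlated; the added one turns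
    additive errors into multiplicative ones. *)
Definition potential n phi (x0 : R) (G : graph n) (u : R) : R :=
  (stat phi G u - x0) ^+ 2 + 2 * stat_spread phi G u + 1.

Lemma sum_unsat n (G : graph n) (h : nat -> R) :
    admissible d G -> (forall i, (d <= i)%N -> h i = 0) ->
  \sum_v h (degree G v) = \sum_(v in unsat d G) h (degree G v).
Proof.
move=> Gadm h0; rewrite (bigID (fun v => v \in unsat d G)) /= [X in _ + X]big1 ?addr0//.
by move=> v /(degree_sat Gadm) ->; rewrite h0.
Qed.

Lemma sum_degreeU1 n (G : graph n) e (h : nat -> R) : e \notin G ->
  \sum_v h (degree (e |: G)%SET v) =
  \sum_v h (degree G v) + \sum_(v in e) (h (degree G v).+1 - h (degree G v)).
Proof.
move=> eG; rewrite [X in _ + X]big_mkcond -big_split; apply: eq_bigr => v _ /=.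
rewrite degreeU1//; case: (v \in e); first by rewrite addn1; ring.
by rewrite addn0 addr0.
Qed.

Lemma sqr_sum_pair n (e : {set 'I_n}) (y : 'I_n -> R) : #|e| = 2%N ->
  (\sum_(v in e) y v) ^+ 2 <= 2 * \sum_(v in e) y v ^+ 2.
Proof.
move=> /eqP/cards2P[a [b [ab ->]]].
rewrite !big_setU1 ?inE//= !big_set1 -subr_ge0.
have -> : 2 * (y a ^+ 2 + y b ^+ 2) - (y a + y b) ^+ 2 = (y a - y b) ^+ 2 by ring.
exact: sqr_ge0.
Qed.

Lemma stat_spread_ge0 n phi (G : graph n) u : 0 <= u -> 0 <= stat_spread phi G u.
Proof. by move=> u0; apply: sumr_ge0 => v _; exact: spread_ge0. Qed.

Lemma unsat_error n (G : graph n) (a b : nat -> R) c :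
    (forall i, `|a i - b i| <= c) ->
  `|\sum_(v in unsat d G) a (degree G v) - \sum_(v in unsat d G) b (degree G v)|
    <= #|unsat d G|%:R * c.
Proof.
move=> ab; rewrite -sumrB; apply: le_trans (ler_norm_sum _ _ _) _.
by rewrite mulr_natl -sumr_const; apply: ler_sum.
Qed.

(** To first order, the drift of the statistic cancels because [smooth] solves the
    Poisson evolution, and the growth of its square is paid for by the decrease
    of the spread ([spread_taylor]).  The errors come from the second order in
    the tick and from the slight non-uniformity of the chosen pair; each is of
    order [1 / U ^ 2] per unsaturated vertex, hence of order [tick] in total,
    times the exponentially small size of [smooth]. *)
Lemma potential_step (B : R) : exists2 C : R, 0 <= C &
  forall n phi x0 (G : graph n) u, test_fun d B phi -> admissible d G ->
    (2 * d <= #|unsat d G|)%N -> tick R d G <= u ->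
  step_exp d (fun H => potential phi x0 H (u - tick R d G)) G
    <= potential phi x0 G u * (1 + C * tick R d G * expR (- (u / 2))).
Proof.
have dge2 : 2 <= d%:R :> R by rewrite ler_nat.
pose D : R := d%:R + 2; have D0 : 0 <= D by rewrite /D; lra.
pose N : R := d%:R * 2 ^+ d; have N0 : 0 <= N by rewrite mulr_ge0 ?exprn_ge0.
have [B0|B0] := ltP B 0.
  exists 0 => // n phi x0 G u [/(_ 0%N)/andP[p0 pB] _]; lra.
(* [K * expR (- (u / 2))] bounds both smoothed functions at time [u - t]; the
   factor 2 pays for the passage from [u - t] to [u]. *)
pose K := 2 * (B + B ^+ 2) * N; have K0 : 0 <= K.
  by rewrite mulr_ge0// mulr_ge0// addr_ge0// exprn_ge0.
pose c1 := 2 * d%:R + 2 * D; have c10 : 0 <= c1 by rewrite /c1; lra.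
pose c := c1 + c1 ^+ 2 * K + 4 * d%:R * B + 4 * D * (1 + 3 * B) + 4 * d%:R.
have c0 : 0 <= c.
  by rewrite !addr_ge0 ?mulr_ge0 ?addr_ge0 ?mulr_ge0 ?exprn_ge0//; lra.
exists (c * K); first by rewrite mulr_ge0.
move=> n phi x0 G u pt Gadm Ubig tu.
have A0 := avail_neq0 R d2 Ubig.
have t0 := tick_gt0 R d2 Ubig; have t1 := tick_le1 R d2 Ubig.
have UT := tickU R d2 Ubig.
rewrite step_expE//; set t := tick R d G in t0 t1 UT tu *.
rewrite -/(avg d G (fun e => potential phi x0 (e |: G)%SET (u - t))).
set E := expR (- (u / 2)); have E0 : 0 < E by exact: expR_gt0.
have u0 : 0 <= u - t by rewrite subr_ge0.
have E1 : E <= 1 by rewrite expR_le1 oppr_le0 divr_ge0// (le_trans (ltW t0)).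
have u'E : expR (- ((u - t) / 2)) <= 2 * E.
  have -> : - ((u - t) / 2) = t / 2 + - (u / 2) by ring.
  rewrite expRD ler_wpM2r ?(ltW E0)//.
  rewrite -[t / 2]opprK expRN -[leLHS]mul1r ler_pdivrMr ?expR_gt0//.
  by have := expR_ge1Dx (- (t / 2)); lra.
pose M := K * E; have M0 : 0 <= M by rewrite mulr_ge0// ltW.
have bound C psi : 0 <= C -> C <= B + B ^+ 2 -> test_fun d C psi ->
    forall k, smooth d psi k (u - t) <= M.
  move=> C0 CB pt' k; apply: le_trans (smooth_decay pt' k u0) _.
  rewrite /M /K -/N; apply: (@le_trans _ _ ((B + B ^+ 2) * N * (2 * E))).
    apply: ler_pM => //; [exact: mulr_ge0|exact: ler_wpM2r].
  by rewrite le_eqVlt; apply/orP; left; apply/eqP; ring.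
have gM : forall k, smooth d phi k (u - t) <= M.
  by apply: (bound B) => //; rewrite lerDl exprn_ge0.
have hM : forall k, smooth d (fun k => phi k ^+ 2) k (u - t) <= M.
  by apply: (bound (B ^+ 2)) (test_fun_sqr pt); rewrite ?exprn_ge0// lerDr.
pose g i := smooth d phi i (u - t); pose s i := spread d phi i (u - t).
have g0 i : 0 <= g i by rewrite /g (smooth_ge0 pt).
have gB i : g i <= B by rewrite /g (smooth_le pt).
have s0 i : 0 <= s i by rewrite /s spread_ge0.
have sM i : s i <= M by exact: le_trans (spread_le _ _ _ _) (hM i).
pose y v := g (degree G v).+1 - g (degree G v).
pose z v := s (degree G v).+1 - s (degree G v).
have yM v : `|y v| <= M.
  by rewrite ler_norml; have := gM (degree G v); have := gM (degree G v).+1;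
    have := g0 (degree G v); have := g0 (degree G v).+1; rewrite /y /g => *;
    apply/andP; split; lra.
have yB v : `|y v| <= B.
  by rewrite ler_norml; have := gB (degree G v); have := gB (degree G v).+1;
    have := g0 (degree G v); have := g0 (degree G v).+1; rewrite /y => *;
    apply/andP; split; lra.
have zM v : `|z v| <= M.
  by rewrite ler_norml; have := sM (degree G v); have := sM (degree G v).+1;
    have := s0 (degree G v); have := s0 (degree G v).+1; rewrite /z => *;
    apply/andP; split; lra.
set Sy := \sum_(v in unsat d G) y v; set Sz := \sum_(v in unsat d G) z v.
pose Sy2 := \sum_(v in unsat d G) y v ^+ 2.
pose Y (e : {set 'I_n}) := \sum_(v in e) y v; pose Z (e : {set 'I_n}) := \sum_(v in e) z v.
have EY : `|avg d G Y - t * Sy| <= 2 * d%:R * t * M.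
  exact: (avg_incident_near d2 Ubig (fun v _ => yM v)).
have EZ : `|avg d G Z - t * Sz| <= 2 * d%:R * t * M.
  exact: (avg_incident_near d2 Ubig (fun v _ => zM v)).
pose Y2 (e : {set 'I_n}) := \sum_(v in e) y v ^+ 2.
have EY2 : `|avg d G Y2 - t * Sy2|
    <= 2 * d%:R * t * (M * B).
  apply: avg_incident_near => // v _.
  by rewrite normrX expr2; apply: ler_pM.
set m := stat phi G (u - t) - x0; set V := stat_spread phi G (u - t).
have pE e : e \in available d G -> potential phi x0 (e |: G)%SET (u - t) =
    m ^+ 2 + 2 * V + 1 + 2 * m * Y e + Y e ^+ 2 + 2 * Z e.
  move=> /availableP[_ eG _]; rewrite /potential /stat /stat_spread.
  rewrite (sum_degreeU1 (fun i => smooth d phi i (u - t)))//.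
  rewrite (sum_degreeU1 (fun i => spread d phi i (u - t)))//.
  rewrite -/(stat phi G (u - t)) -/(stat_spread phi G (u - t)) -/V.
  rewrite -/(Y e) -/(Z e) /m; ring.
have h1 : avg d G (fun e => potential phi x0 (e |: G)%SET (u - t)) <=
    m ^+ 2 + 2 * V + 1 + 2 * m * avg d G Y
    + 2 * avg d G Y2 + 2 * avg d G Z.
  rewrite -!avgZ -[X in X + _ + _ + _](avg_cst d2 Ubig) -!avgD.
  apply: avg_le => // e eA; rewrite pE// lerD2r lerD2l.
  by apply: sqr_sum_pair; have [] := availableP eA.
apply: le_trans h1 _.
have eX : `|stat phi G u - (stat phi G (u - t) + t * Sy)| <= 2 * D * t * M.
  have -> : stat phi G (u - t) + t * Sy = \sum_(v in unsat d G)
      (fun i => g i + t * (g i.+1 - g i)) (degree G v).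
    rewrite big_split -mulr_sumr /= -/Sy; congr (_ + _).
    rewrite /stat (@sum_unsat n G (fun i => smooth d phi i (u - t)))// => i.
    by move=> di; rewrite (smooth_eq0 pt).
  rewrite /stat (@sum_unsat n G (fun i => smooth d phi i u))//; last first.
    by move=> i; by move=> di; rewrite (smooth_eq0 pt).
  apply: le_trans (@unsat_error n G (fun i => smooth d phi i u)
    (fun i => g i + t * (g i.+1 - g i)) (D * t ^+ 2 * M) _) _.
    by move=> i; have := smooth_taylor pt i d2 u0 (ltW t0) t1 gM; rewrite subrK.
  have -> : #|unsat d G|%:R * (D * t ^+ 2 * M) = #|unsat d G|%:R * t * (D * t * M) by ring.
  by rewrite UT !mulrA.
have eV : `|stat_spread phi G u - (V + t * Sz + t * Sy2)| <= 2 * D * (1 + 3 * B) * t * M.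
  have -> : V + t * Sz + t * Sy2 = \sum_(v in unsat d G)
      (fun i => s i + t * (s i.+1 - s i) + t * (g i.+1 - g i) ^+ 2) (degree G v).
    rewrite big_split big_split -!mulr_sumr /= -/Sz -/Sy2; congr (_ + _ + _).
    rewrite /V /stat_spread (@sum_unsat n G (fun i => spread d phi i (u - t)))// => i.
    by move=> di; rewrite (spread_eq0 pt).
  rewrite /stat_spread (@sum_unsat n G (fun i => spread d phi i u))//; last first.
    by move=> i; by move=> di; rewrite (spread_eq0 pt).
  apply: le_trans (@unsat_error n G (fun i => spread d phi i u)
    (fun i => s i + t * (s i.+1 - s i) + t * (g i.+1 - g i) ^+ 2)
    (D * (1 + 3 * B) * t ^+ 2 * M) _) _.
    by move=> i; have := spread_taylor pt i d2 u0 (ltW t0) t1 gM hM; rewrite subrK.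
  have -> : #|unsat d G|%:R * (D * (1 + 3 * B) * t ^+ 2 * M) =
    #|unsat d G|%:R * t * (D * (1 + 3 * B) * t * M) by ring.
  by rewrite UT !mulrA.
have V0 : 0 <= stat_spread phi G u.
  by apply: stat_spread_ge0; rewrite (le_trans _ tu)// ltW.
rewrite /potential.
have -> : c * K * t * E = c * (t * M) by rewrite /M; ring.
have MK : M <= K by rewrite /M ler_piMr.
move: (avg d G Y) (avg d G Z) (avg d G Y2) EY EZ EY2 => aY aZ aY2 EY EZ EY2.
move: (stat phi G u) (stat_spread phi G u) eX eV V0 => X V1 eX eV V10.
have := sqr_ge0 aY.
pose tm := t * M; have tm0 : 0 <= tm by rewrite mulr_ge0// ltW.
have tmK : tm <= K by rewrite -[K]mul1r ler_pM// ltW.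
(* The drift left over after the cancellation of the first order. *)
pose eps := m + aY - (X - x0).
have eps_le : `|eps| <= c1 * tm.
  have -> : eps = (aY - t * Sy) - (X - (stat phi G (u - t) + t * Sy)).
    by rewrite /eps /m; ring.
  apply: le_trans (ler_normB _ _) _; rewrite /c1 mulrDl.
  by apply: lerD; [apply: le_trans EY _|apply: le_trans eX _]; rewrite /tm !mulrA.
have eps2 : eps ^+ 2 <= c1 ^+ 2 * K * tm.
  rewrite -real_normK ?num_real//; apply: (@le_trans _ _ ((c1 * tm) ^+ 2)).
    by rewrite lerXn2r// nnegrE; exact: mulr_ge0.
  by rewrite exprMn -mulrA ler_wpM2l ?exprn_ge0// expr2 ler_wpM2r.
have sq0 := sqr_ge0 (X - x0).
have cross : 2 * (X - x0) * eps <= ((X - x0) ^+ 2 + 1) * (c1 * tm).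
  apply: (@le_trans _ _ (((X - x0) ^+ 2 + 1) * `|eps|)); last first.
    by rewrite ler_wpM2l// addr_ge0.
  have : 2 * (X - x0) * eps <= 2 * `|X - x0| * `|eps|.
    by rewrite -mulrA -[leRHS]mulrA ler_wpM2l// -normrM ler_norm.
  move=> /le_trans; apply; rewrite ler_wpM2r//.
  rewrite -[(X - x0) ^+ 2]real_normK ?num_real//.
  by have := sqr_ge0 (`|X - x0| - 1); lra.
move: EY2 EZ eV; rewrite !ler_norml => /andP[_ EY2] /andP[_ EZ] /andP[eV _].
have mE : m ^+ 2 + 2 * m * aY = (X - x0) ^+ 2 + 2 * (X - x0) * eps + eps ^+ 2 - aY ^+ 2.
  by rewrite /eps; ring.
move=> aY0.
set Q := (X - x0) ^+ 2 in sq0 cross mE *.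
have rest : (Q + 2 * V1 + 1) * (c * (t * M)) >= c * tm + (Q + 2 * V1) * (c1 * tm).
  rewrite -/tm; have cc1 : c1 <= c.
    rewrite -subr_ge0; have -> : c - c1 = c1 ^+ 2 * K + 4 * d%:R * B
      + 4 * D * (1 + 3 * B) + 4 * d%:R by rewrite /c; ring.
    by rewrite !addr_ge0 ?mulr_ge0 ?addr_ge0 ?mulr_ge0 ?exprn_ge0//; lra.
  have : (Q + 2 * V1) * (c1 * tm) <= (Q + 2 * V1) * (c * tm).
    by rewrite ler_wpM2l ?ler_wpM2r// addr_ge0// mulr_ge0.
  lra.
have Vc : 0 <= 2 * V1 * (c1 * tm) by apply: mulr_ge0; apply: mulr_ge0.
have t2 : 2 * d%:R * t * (M * B) = 2 * d%:R * B * tm by rewrite /tm; ring.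
have t3 : 2 * d%:R * t * M = 2 * d%:R * tm by rewrite /tm; ring.
have t4 : 2 * D * (1 + 3 * B) * t * M = 2 * D * (1 + 3 * B) * tm by rewrite /tm; ring.
rewrite t2 in EY2; rewrite t3 in EZ; rewrite t4 in eV.
have cE : c * tm = c1 * tm + c1 ^+ 2 * K * tm + 4 * d%:R * B * tm
  + 4 * D * (1 + 3 * B) * tm + 4 * d%:R * tm by rewrite /c; ring.
have -> : (Q + 2 * V1 + 1) * (1 + c * (t * M)) =
  (Q + 2 * V1 + 1) + (Q + 2 * V1 + 1) * (c * (t * M)) by ring.
lra.
Qed.

End Lyapunov.

(** * Chebyshev's inequality along the clock *)

Section Bound.
Variables (R : realType) (d : nat).
Hypothesis d2 : (2 <= d)%N.

(** A primitive of [C * expR (- (u / 2))], exponentiated.  As the clock runs down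
    it decreases just fast enough to absorb the error factor of every step, and
    it stays between [1] and [expR (2 * C)]. *)
Definition damping (C u : R) : R := expR (2 * C * (1 - expR (- (u / 2)))).

Lemma damping_ge1 C u : 0 <= C -> 0 <= u -> 1 <= damping C u.
Proof.
move=> C0 u0; rewrite -[leLHS]expR0 ler_expR; apply: mulr_ge0; first exact: mulr_ge0.
by rewrite subr_ge0 expR_le1 oppr_le0 divr_ge0.
Qed.

Lemma damping_le C u : 0 <= C -> damping C u <= expR (2 * C).
Proof.
by move=> C0; rewrite ler_expR ler_piMr ?mulr_ge0// lerBlDr lerDl expR_ge0.
Qed.

Lemma damping_step C u t : 0 <= C -> 0 <= t ->
  damping C (u - t) * (1 + C * t * expR (- (u / 2))) <= damping C u.
Proof.
move=> C0 t0; set E := expR (- (u / 2)); have E0 : 0 <= E by exact: expR_ge0.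
apply: (@le_trans _ _ (damping C (u - t) * expR (C * t * E))).
  by rewrite ler_wpM2l ?expR_ge0// expR_ge1Dx.
rewrite /damping -expRD ler_expR -/E.
have -> : - ((u - t) / 2) = t / 2 + - (u / 2) by ring.
rewrite expRD -/E; have h := expR_ge1Dx (t / 2).
have : (1 + t / 2) * E <= expR (t / 2) * E by rewrite ler_wpM2r.
move=> h2; have : 2 * C * ((1 + t / 2) * E) <= 2 * C * (expR (t / 2) * E).
  by rewrite ler_wpM2l// mulr_ge0.
lra.
Qed.

(** Chebyshev's inequality for several statistics watched simultaneously.  The
    clock starts at [u0] and runs down by [tick]; it is not part of the state of
    the process, but the bound is proved by induction on the remaining number of
    steps, for every graph and every reading of the clock.  If the clock runs
    out before step [s] the induction stops there, which is why an expired clock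
    also has to show as a large deviation. *)
Lemma prob_bad_le : exists2 C : R, 0 <= C &
  forall (n s : nat) (I : finType) (phi : I -> nat -> R) (c : I -> R) (u0 : R)
    (bad : graph n -> bool),
    (forall i, test_fun d d%:R (phi i)) -> (forall i, 0 <= c i) -> 0 <= u0 ->
    (2 * s + 2 * d * d <= d * n)%N ->
    (forall (G : graph n) u, admissible d G -> (#|G| <= s)%N -> 0 <= u <= u0 ->
       u < tick R d G \/ (#|G| = s /\ bad G) ->
       exists i, 1 <= c i * (stat d (phi i) G u
                             - stat d (phi i) (finset.set0 : graph n) u0) ^+ 2) ->
  iter s (@step_exp R d n) (fun G => (bad G)%:R) finset.set0
    <= C * \sum_i c i * (2 * stat_spread d (phi i) (finset.set0 : graph n) u0 + 1).
Proof.
have [C C0 HC] := potential_step d2 (d%:R : R).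
exists (expR (2 * C)); first exact: expR_ge0.
move=> n s I phi c u0 bad ptest c0 u00 ns cover.
pose x0 i := stat d (phi i) (finset.set0 : graph n) u0.
pose Theta (G : graph n) u := \sum_i c i * potential d (phi i) (x0 i) G u.
have pot_ge i (G : graph n) u : 0 <= u ->
    (stat d (phi i) G u - x0 i) ^+ 2 <= potential d (phi i) (x0 i) G u.
  by move=> u1; have := stat_spread_ge0 d (phi i) G u1; rewrite /potential; lra.
have pot_ge0 i (G : graph n) u : 0 <= u -> 0 <= potential d (phi i) (x0 i) G u.
  by move=> u1; apply: le_trans (pot_ge _ _ _ u1); rewrite sqr_ge0.
have Theta_ge0 G u : 0 <= u -> 0 <= Theta G u.
  by move=> u1; apply: sumr_ge0 => i _; rewrite mulr_ge0 ?pot_ge0.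
have Theta1 G u : admissible d G -> (#|G| <= s)%N -> 0 <= u <= u0 ->
    u < tick R d G \/ (#|G| = s /\ bad G) -> 1 <= Theta G u.
  move=> Gadm Gs /[dup] /andP[u1 _] u01 /(cover G u Gadm Gs u01)[i hi].
  apply: (le_trans hi); rewrite /Theta (bigD1 i)//=.
  rewrite -[leLHS]addr0 lerD ?ler_wpM2l ?pot_ge//.
  by apply: sumr_ge0 => k _; rewrite mulr_ge0 ?pot_ge0.
have main k G u : admissible d G -> (#|G| + k = s)%N -> 0 <= u <= u0 ->
    iter k (@step_exp R d n) (fun G => (bad G)%:R) G <= damping C u * Theta G u.
  elim: k G u => [|k IH] G u Gadm Gk u01; have /andP[u1 uu0] := u01.
    rewrite addn0 in Gk; rewrite /=; case: (boolP (bad G)) => bG.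
      apply: (@le_trans _ _ (1 * 1)); first by rewrite mul1r.
      apply: ler_pM => //; first exact: damping_ge1.
      by apply: Theta1 => //; rewrite ?Gk//; right.
    by rewrite mulr_ge0 ?Theta_ge0// (le_trans ler01)// damping_ge1.
  have Gs : (#|G| <= s)%N by rewrite -Gk leq_addr.
  have [ut|tu] := ltP u (tick R d G).
    apply: (@le_trans _ _ 1).
      rewrite -[leRHS](iter_step_exp_cst d 1 k.+1 G).
      by apply: iter_step_exp_le => H; case: (bad H).
    rewrite -[leLHS]mul1r; apply: ler_pM => //; first exact: damping_ge1.
    by apply: Theta1 => //; left.
  (* [2 * d * d] missing half-edges leave [2 * d] vertices unsaturated. *)
  have Ubig : (2 * d <= #|unsat d G|)%N.
    have := deficiency_le_unsat Gadm => h.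
    have : (d * (2 * d) <= d * #|unsat d G|)%N.
      rewrite -(leq_add2r (2 * #|G|)); apply: leq_trans h; apply: leq_trans ns.
      by rewrite addnC mulnCA mulnA leq_add2r leq_mul2l.
    by rewrite leq_pmul2l// (ltn_trans _ d2).
  have A0 := avail_neq0 R d2 Ubig.
  have t0 := tick_gt0 R d2 Ubig.
  rewrite iterS; apply: (@le_trans _ _
      (step_exp d (fun H => damping C (u - tick R d G) * Theta H (u - tick R d G)) G)).
    rewrite !step_expE// ler_pM2r ?invr_gt0 ?card_avail_gt0//.
    apply: ler_sum => e eA; apply: IH; first exact: admissibleU1.
      by have [_ eG _] := availableP eA; rewrite cardsU1 eG -Gk addnS.
    by rewrite subr_ge0 tu (le_trans _ uu0)// gerBl ltW.
  have -> : step_exp d (fun H => damping C (u - tick R d G) * Theta H (u - tick R d G)) G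
    = damping C (u - tick R d G) * \sum_i c i *
      step_exp d (fun H => potential d (phi i) (x0 i) H (u - tick R d G)) G.
    rewrite /step_exp mulr_sumr; under [RHS]eq_bigr do rewrite !mulr_sumr.
    rewrite exchange_big; apply: eq_bigr => H _; rewrite !mulr_sumr.
    by apply: eq_bigr => i _; ring.
  apply: (@le_trans _ _ (damping C (u - tick R d G) * \sum_i c i *
      (potential d (phi i) (x0 i) G u * (1 + C * tick R d G * expR (- (u / 2)))))).
    by rewrite ler_wpM2l ?expR_ge0//; apply: ler_sum => i _; rewrite ler_wpM2l// HC.
  under eq_bigr do rewrite mulrA.
  rewrite -mulr_suml -/(Theta G u) [X in _ * X]mulrC mulrA ler_wpM2r ?Theta_ge0//.
  by apply: damping_step => //; exact: ltW.
apply: (@le_trans _ _ (damping C u0 * Theta finset.set0 u0)).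
  by apply: main; rewrite ?cards0 ?u00 ?lexx//; exact: admissible0.
apply: ler_pM; [exact: expR_ge0|exact: Theta_ge0|exact: damping_le|].
by apply: ler_sum => i _; rewrite /potential /x0 subrr expr0n add0r.
Qed.

End Bound.

(** * The test functions for degrees and for the deficiency *)

Section TestFunctions.
Variables (R : realType) (d : nat).
Hypothesis d2 : (2 <= d)%N.

Definition at_degree (k i : nat) : R := (i == k)%:R.

Definition deficiency (i : nat) : R := (d - i)%:R.

Lemma at_degree_test k : (k < d)%N -> test_fun d d%:R (at_degree k).
Proof.
move=> kd; split=> i; rewrite /at_degree; last by case: eqVneq => // ->; rewrite leqNgt kd.
by case: eqVneq => _ //=; rewrite ?ler01 ?lexx ?ler0n ?ler1n ?(ltnW d2).
Qed.

Lemma deficiency_test : test_fun d d%:R deficiency.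
Proof.
split=> i; rewrite /deficiency; first by rewrite ler0n ler_nat leq_subr.
by rewrite -subn_eq0 => /eqP ->.
Qed.

Lemma smooth_at_degree k i u : (k < d)%N ->
  smooth d (at_degree k) i u = if (i <= k)%N then poisson (k - i) u else 0.
Proof.
move=> kd; rewrite /smooth; case: leqP => ik.
  have kid : (k - i < d)%N by rewrite (leq_ltn_trans (leq_subr _ _)).
  rewrite (bigD1 (Ordinal kid))//= /at_degree subnKC// eqxx mulr1 big1 ?addr0//.
  move=> l /eqP lk; case: eqP => [ilk|_]; last by rewrite mulr0.
  by case: lk; apply/val_inj; rewrite /= -ilk addKn.
apply: big1 => l _; rewrite /at_degree gtn_eqF ?mulr0//.
by rewrite (leq_trans ik)// leq_addr.
Qed.

Lemma smooth_deficiency_ge i r : 0 <= r ->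
  (1 - r) * deficiency i <= smooth d deficiency i r.
Proof.
move=> r0; rewrite /smooth; case: d d2 => // d' _.
rewrite big_ord_recl poisson0 addn0 -[leLHS]addr0 lerD//.
  by rewrite ler_wpM2r// (le_trans _ (expR_ge1Dx _)).
by apply: sumr_ge0 => k _; rewrite mulr_ge0// poisson_ge0.
Qed.

(** The deficiency of an unsaturated vertex drops by one as soon as its clock
    rings, which happens with probability [1 - expR (- r)]. *)
Lemma smooth_deficiency_le i r : (i < d)%N -> 0 <= r ->
  smooth d deficiency i r <= deficiency i - (1 - expR (- r)).
Proof.
move=> id r0; have := poisson_sum_le1 d r0; rewrite /smooth.
have split0 (F : nat -> R) : \sum_(k < d) F k = F 0%N + \sum_(1 <= k < d) F k.
  by rewrite -(big_mkord xpredT F) big_ltn// (ltn_trans _ d2).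
rewrite (split0 (fun k => poisson k r)) (split0 (fun k => poisson k r * deficiency (i + k))).
rewrite poisson0 addn0; set P := \sum_(_ <= _ < _) poisson _ r => P1.
apply: (@le_trans _ _ (expR (- r) * deficiency i + P * (deficiency i - 1))).
  rewrite lerD2l mulr_suml; apply: ler_sum_nat => k /andP[k1 _].
  rewrite ler_wpM2l ?poisson_ge0// /deficiency lerBrDr -[1]/(1%:R) -natrD ler_nat.
  by rewrite addn1 ltn_sub2l// -[X in (X < _)%N]addn0 ltn_add2l.
have D1 : 1 <= deficiency i by rewrite /deficiency ler1n subn_gt0.
have := expR_ge0 (- r); nra.
Qed.

End TestFunctions.

(** * Comparison of nearby Poisson weights *)

Section PoissonWeights.
Variable R : realType.
Implicit Types (m t : R) (d j k l : nat).

Lemma poisson_shift d k i m : 0 <= m -> (k + i <= d)%N ->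
  poisson k m * m ^+ i <= d`!%:R * poisson (k + i) m.
Proof.
move=> m0 kid; have -> : poisson k m * m ^+ i =
    ((k + i)`!%:R / k`!%:R) * poisson (k + i) m.
  by rewrite /poisson exprD; field; rewrite !gt_eqF// fact_gt0R.
rewrite ler_wpM2r ?poisson_ge0// ler_pdivrMr ?fact_gt0R//.
apply: (@le_trans _ _ d`!%:R).
  by rewrite ler_nat; exact: leq_fact.
by rewrite ler_peMr// fact_ge1R.
Qed.

(** Consecutive weights differ by a factor of order [m], and [t <= m], so that
    all but one of the [l] factors [t] are paid for by raising the index. *)
Lemma poisson_shortfall d j l m t : (0 < l <= j)%N -> (j <= d)%N ->
    0 <= m -> 0 <= t -> t <= m ->
  poisson (j - l) m * t ^+ l <= d`!%:R * (t * poisson j.-1 m).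
Proof.
case: l => // l /andP[_ lj] jd m0 t0 tm.
apply: (@le_trans _ _ (t * (poisson (j - l.+1) m * m ^+ l))).
  rewrite exprS mulrCA ler_wpM2l// ler_wpM2l ?poisson_ge0//.
  by rewrite lerXn2r ?nnegrE.
rewrite [leRHS]mulrCA ler_wpM2l//; apply: le_trans (poisson_shift (d := d) m0 _) _.
  by lia.
by rewrite (_ : (j - l.+1 + l)%N = j.-1)//; lia.
Qed.

(** For fluctuations, half of the [2 * l] factors [t] is enough. *)
Lemma poisson_shortfall_sqr d j l m t : (l <= j)%N -> (j <= d)%N ->
    0 <= m -> 0 <= t -> t <= 1 -> t <= m ->
  poisson (j - l) m * (t ^+ l) ^+ 2 <= d`!%:R * poisson j m.
Proof.
move=> lj jd m0 t0 t1 tm; apply: (@le_trans _ _ (poisson (j - l) m * m ^+ l)).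
  rewrite ler_wpM2l ?poisson_ge0// expr2 -[leRHS]mul1r ler_pM ?exprn_ge0//.
    exact: exprn_ile1.
  by rewrite lerXn2r ?nnegrE.
by apply: le_trans (poisson_shift (d := d) m0 _) _; rewrite subnK.
Qed.

Lemma poisson_double k m t : 0 <= m -> 0 <= t -> ((0 < k)%N -> t <= m) ->
  poisson k (m + t) <= 2 ^+ k * poisson k m.
Proof.
move=> m0 t0 tm; rewrite /poisson !mulrA -exprMn ler_wpM2r ?invr_ge0//.
apply: ler_pM; [by rewrite exprn_ge0// addr_ge0|exact: expR_ge0| |].
  case: k tm => [|k] /= tm; first by rewrite !expr0.
  by rewrite lerXn2r ?nnegrE ?addr_ge0 ?mulr_ge0//; have := tm isT; lra.
by rewrite ler_expR; lra.
Qed.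

Lemma poissonD_ge k m t : 0 <= m -> 0 <= t ->
  (1 - t) * poisson k m <= poisson k (m + t).
Proof.
move=> m0 t0; rewrite poissonD big_ord_recl poisson0 subn0 -[leLHS]addr0 lerD//.
  by rewrite ler_wpM2r ?poisson_ge0// (le_trans _ (expR_ge1Dx _)).
by apply: sumr_ge0 => i _; rewrite mulr_ge0 ?poisson_ge0.
Qed.

Lemma poissonD_le d j m t : (j < d)%N -> 0 <= m -> 0 <= t -> ((0 < j)%N -> t <= m) ->
  poisson j (m + t) <= poisson j m
    + d%:R * d`!%:R * (t * (if (0 < j)%N then poisson j.-1 m else 0)).
Proof.
move=> jd m0 t0 tm; rewrite poissonD big_ord_recl subn0 poisson0 lerD//.
  by rewrite ler_piMl ?poisson_ge0// expR_le1 oppr_le0.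
case: ltnP => [j0|]; last by rewrite leqn0 => /eqP ->; rewrite big_ord0 !mulr0.
apply: (@le_trans _ _ (\sum_(i < j) d`!%:R * (t * poisson j.-1 m))).
  apply: ler_sum => i _; rewrite lift0.
  apply: le_trans (poisson_shortfall (l := i.+1) (d := d) _ _ m0 t0 (tm j0)).
  - by rewrite mulrC ler_wpM2l ?poisson_ge0// poisson_le_exp.
  - by rewrite /= ltn_ord.
  - exact: ltnW.
rewrite sumr_const card_ord -[leLHS]mulr_natl -mulrA ler_wpM2r//.
  by apply: mulr_ge0 => //; apply: mulr_ge0 => //; exact: poisson_ge0.
by rewrite ler_nat ltnW.
Qed.

End PoissonWeights.

(** * The statistics on a given graph *)

Section Statistics.
Variables (R : realType) (d n : nat).
Hypothesis d2 : (2 <= d)%N.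
Implicit Types (G : graph n) (u r : R).

Lemma stat_empty (phi : nat -> R) u :
  stat d phi (finset.set0 : graph n) u = n%:R * smooth d phi 0 u.
Proof.
rewrite /stat (eq_bigr (fun=> smooth d phi 0 u)); last by move=> v _; rewrite degree0.
by rewrite sumr_const card_ord mulr_natl.
Qed.

Lemma stat_spread_empty (phi : nat -> R) u :
  stat_spread d phi (finset.set0 : graph n) u = n%:R * spread d phi 0 u.
Proof.
rewrite /stat_spread (eq_bigr (fun=> spread d phi 0 u)); last by move=> v _; rewrite degree0.
by rewrite sumr_const card_ord mulr_natl.
Qed.

Lemma sum_deficiency G : admissible d G ->
  \sum_v deficiency R d (degree G v) = d%:R * n%:R - 2 * #|G|%:R.
Proof.
move=> Gadm; apply/eqP; rewrite eq_sym subr_eq -natr_sum -!natrM -natrD.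
by rewrite deficiencyE.
Qed.

Lemma stat_deficiency_ge G r : admissible d G -> 0 <= r ->
  (1 - r) * (d%:R * n%:R - 2 * #|G|%:R) <= stat d (deficiency R d) G r.
Proof.
move=> Gadm r0; rewrite -sum_deficiency// mulr_sumr; apply: ler_sum => v _.
exact: smooth_deficiency_ge.
Qed.

Lemma stat_deficiency_le G r : admissible d G -> 0 <= r ->
  stat d (deficiency R d) G r
    <= (d%:R * n%:R - 2 * #|G|%:R) - (1 - expR (- r)) * #|unsat d G|%:R.
Proof.
move=> Gadm r0; rewrite -sum_deficiency// /stat.
have pt := deficiency_test R d.
rewrite (sum_unsat (d := d) (h := fun i => smooth d (deficiency R d) i r))//; last first.
  by move=> i di; rewrite (smooth_eq0 pt).
rewrite (sum_unsat (d := d) (h := deficiency R d))//; last by move=> i; exact: pt.2.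
rewrite mulr_natr -sumr_const -sumrB; apply: ler_sum => v vU.
by apply: smooth_deficiency_le => //; move: vU; rewrite inE.
Qed.

Lemma sum_num_degree N G (h : nat -> R) : (forall i, (N <= i)%N -> h i = 0) ->
  \sum_v h (degree G v) = \sum_(k < N) (num_degree k G)%:R * h k.
Proof.
move=> h0; under [RHS]eq_bigr => k _.
  rewrite /num_degree -sum1_card natr_sum mulr_suml.
  rewrite (eq_bigl (fun v => degree G v == k)); last by move=> v; rewrite inE.
  rewrite big_mkcond.
over.
rewrite exchange_big; apply: eq_bigr => v _ /=; case: (ltnP (degree G v) N) => dN.
  rewrite (bigD1 (Ordinal dN))//= eqxx mul1r big1 ?addr0// => k /eqP kv.
  by case: eqP => // vk; case: kv; apply/val_inj.
by rewrite h0// big1// => k _; rewrite gtn_eqF// (leq_trans _ dN).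
Qed.

Lemma stat_at_degreeE k G r : (k < d)%N -> stat d (at_degree R k) G r =
  \sum_(i < k.+1) (num_degree i G)%:R * poisson (k - i) r.
Proof.
move=> kd; rewrite /stat.
rewrite (sum_num_degree (N := k.+1) G (h := fun i => smooth d (at_degree R k) i r)).
  by apply: eq_bigr => i _; rewrite smooth_at_degree// -ltnS ltn_ord.
by move=> i ki; rewrite smooth_at_degree// leqNgt ki.
Qed.

Lemma num_degree_le k G r : (k < d)%N -> 0 <= r ->
  (num_degree k G)%:R <= expR r * stat d (at_degree R k) G r.
Proof.
move=> kd r0; rewrite stat_at_degreeE// big_ord_recr /= subnn poisson0.
rewrite mulrDr -[leLHS]add0r lerD//.
  by rewrite mulr_ge0 ?expR_ge0// sumr_ge0// => i _; rewrite mulr_ge0// poisson_ge0.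
by rewrite mulrCA -expRD subrr expR0 mulr1.
Qed.

End Statistics.

Section ShortTime.
Variable R : realType.
Implicit Types r z t : R.


Lemma expRN_le_half t : 0 <= t <= 1 -> t / 2 <= 1 - expR (- t).
Proof.
move=> /andP[t0 t1]; suff : expR (- t) <= 1 - t / 2 by lra.
rewrite expRN -[leLHS]mul1r ler_pdivrMr ?expR_gt0//.
apply: (@le_trans _ _ ((1 - t / 2) * (1 + t))); first by nra.
by rewrite ler_wpM2l ?expR_ge1Dx//; lra.
Qed.

Lemma expR_sub1_le r : 0 <= r <= 1 / 2 -> expR r <= 1 + 2 * r.
Proof.
move=> /andP[r0 r1]; have h := expR_ge1Dx (- r); have rr : 0 < 1 - r by lra.
have : expR r * (1 - r) <= 1.
  apply: (@le_trans _ _ (expR r * expR (- r))); first by rewrite ler_wpM2l ?expR_ge0.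
  by rewrite -expRD subrr expR0.
have := expR_ge0 r; nra.
Qed.

Lemma le_double_of_expRN r z : 0 <= r -> 0 <= z <= 1 / 2 ->
  1 - expR (- r) <= z -> r <= 2 * z.
Proof.
move=> r0 /andP[z0 z1] hz; have h := expR_ge1Dx r.
have : expR (- r) * (1 + r) <= 1.
  apply: (@le_trans _ _ (expR (- r) * expR r)); first by rewrite ler_wpM2l ?expR_ge0.
  by rewrite -expRD addNr expR0.
have : (1 - z) * (1 + r) <= expR (- r) * (1 + r) by rewrite ler_wpM2r//; lra.
nra.
Qed.

End ShortTime.

(** * From the statistics to the number of vertices of degree j *)

Section Deviations.
Variables (R : realType) (d j n s : nat) (m w : R).
Hypotheses (d2 : (2 <= d)%N) (jd : (j < d)%N).

Definition weight k : R := n%:R * poisson k m.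

Definition prev_weight : R := if (0 < j)%N then weight j.-1 else 0.

Definition total_deficiency : R := \sum_(k < d) (d - k)%:R * weight k.

Local Notation q := (weight j).
Local Notation q' := prev_weight.
Local Notation L := total_deficiency.
Local Notation F := (d`!%:R : R).
Local Notation Q := ((4 * d%:R) ^+ d : R).

(** The error terms of [num_degree_near], in units of [slack * w * sqrt q]. *)
Definition error_const : R := d%:R * F + 2 + d%:R * (2 ^+ d.+1 + 4) * Q * F.

(** Chosen so that all error terms together amount to [w * sqrt q]. *)
Definition slack : R := (2 * error_const + 8 * d%:R)^-1.

(** The clock is set to [m + delay], so that it is unlikely to run out before step
    [s].  The weight of degree [j] moves at a rate of at most [q + q'], so that
    this extra time changes it by a small part of the permitted deviation. *)
Definition delay : R := slack * w * Num.sqrt q / (q + q').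

Hypotheses (m0 : 0 < m) (w0 : 0 < w) (q1 : 1 <= q) (wq : w <= Num.sqrt q).
Hypothesis sL : d%:R * n%:R - 2 * s%:R = L.

Local Notation rt := (Num.sqrt q).
Local Notation E1 := error_const.
Local Notation eps := slack.
Local Notation del := delay.

Lemma weight_ge0 k : 0 <= weight k.
Proof. by rewrite mulr_ge0// poisson_ge0// ltW. Qed.

Lemma prev_weight_ge0 : 0 <= q'.
Proof. by rewrite /prev_weight; case: ifP => // _; exact: weight_ge0. Qed.

Lemma sqrt_weight_sqr : rt ^+ 2 = q.
Proof. by rewrite sqr_sqrtr// weight_ge0. Qed.

Lemma sqrt_weight_ge1 : 1 <= rt.
Proof. by rewrite -[leLHS]sqrtr1 ler_wsqrtr. Qed.

Lemma error_const_ge : d%:R * F + 2 <= E1.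
Proof.
by rewrite /error_const lerDl mulr_ge0// mulr_ge0 ?exprn_ge0 ?mulr_ge0 ?addr_ge0 ?exprn_ge0.
Qed.

Lemma error_const_ge0 : 0 <= E1.
Proof. by apply: le_trans error_const_ge; rewrite addr_ge0// mulr_ge0. Qed.

Lemma slackE : eps * (2 * E1 + 8 * d%:R) = 1.
Proof.
have := error_const_ge0; have := (d_ge2 R d2) => dd e1.
by rewrite /slack mulVf// gt_eqF//; lra.
Qed.

Lemma slack_gt0 : 0 < eps.
Proof. by have := error_const_ge0; have := (d_ge2 R d2); rewrite invr_gt0; lra. Qed.

Lemma slack_le : 8 * d%:R * eps <= 1.
Proof.
have h : 0 <= eps * E1 by rewrite mulr_ge0 ?error_const_ge0// ltW ?slack_gt0.
by have := slackE; lra.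
Qed.

Lemma denom_gt0 : 0 < q + q'.
Proof. by have := prev_weight_ge0; have := q1; lra. Qed.

Lemma delay_mul : del * (q + q') = eps * w * rt.
Proof. by rewrite /delay divfK// gt_eqF// denom_gt0. Qed.

Lemma delay_gt0 : 0 < del.
Proof.
rewrite divr_gt0 ?denom_gt0// !mulr_gt0 ?slack_gt0//.
exact: lt_le_trans sqrt_weight_ge1.
Qed.

Lemma wrt_le : w * rt <= q.
Proof.
by rewrite -[leRHS]sqrt_weight_sqr expr2 ler_wpM2r.
Qed.

Lemma delay_le_slack : del <= eps.
Proof.
rewrite ler_pdivrMr ?denom_gt0// -mulrA ler_wpM2l ?(ltW slack_gt0)//.
by have := wrt_le; have := prev_weight_ge0; lra.
Qed.

Lemma delay_le1 : del <= 1 / 16.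
Proof.
apply: le_trans delay_le_slack _; have := slack_le; have := (d_ge2 R d2).
have := slack_gt0; nra.
Qed.

Lemma weight_pred : (0 < j)%N -> weight j.-1 * m = j%:R * q.
Proof.
case: j => // j' _; rewrite /weight /poisson factS natrM exprS /=.
by field; rewrite -[1]/(1%:R) -natrD !pnatr_eq0 -lt0n fact_gt0.
Qed.

(** The delay at most doubles [m], because [q'] is at least [q / m]. *)
Lemma delay_le_m : (0 < j)%N -> del <= m.
Proof.
move=> j0; have h := weight_pred j0; have q'E : q' = weight j.-1 by rewrite /prev_weight j0.
rewrite ler_pdivrMr ?denom_gt0//; have := wrt_le => h1.
have e0 := slack_gt0; have e1 : eps <= 1.
  by have := slack_le; have := (d_ge2 R d2); nra.
apply: (@le_trans _ _ (1 * q)).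
  by rewrite -mulrA ler_pM ?(ltW e0) ?mulr_ge0 ?(ltW w0).
rewrite mul1r mulrDr [m * q']mulrC q'E h.
have j1 : 1 <= j%:R :> R by rewrite ler1n.
have qj : q <= j%:R * q by rewrite ler_peMl// weight_ge0.
have mq : 0 <= m * q by rewrite mulr_ge0 ?weight_ge0 ?(ltW m0).
lra.
Qed.

Lemma total_ge_pair : q + q' <= L.
Proof.
rewrite /total_deficiency (bigD1 (Ordinal jd))//= lerD//.
  by rewrite ler_peMl ?weight_ge0// ler1n subn_gt0.
rewrite /prev_weight; case: ltnP => [j0|_]; last first.
  by apply: sumr_ge0 => k _; rewrite mulr_ge0 ?weight_ge0.
have j'd : (j.-1 < d)%N by rewrite (leq_ltn_trans (leq_pred _)).
rewrite (bigD1 (Ordinal j'd))/=; last by rewrite -val_eqE /= neq_ltn ltn_predL j0.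
rewrite -[leLHS]addr0 lerD//; first by rewrite ler_peMl ?weight_ge0// ler1n subn_gt0.
by apply: sumr_ge0 => k _; rewrite mulr_ge0 ?weight_ge0.
Qed.

Lemma total_ge1 : 1 <= L.
Proof. by have := total_ge_pair; have := prev_weight_ge0; have := q1; lra. Qed.

Lemma delay_total : eps * w <= del * L.
Proof.
have h := total_ge_pair; have r1 := sqrt_weight_ge1.
apply: (@le_trans _ _ (del * (q + q'))); last by rewrite ler_wpM2l// ltW ?delay_gt0.
by rewrite delay_mul ler_peMr// mulr_ge0// ltW ?slack_gt0.
Qed.

Definition target_deficiency : R := n%:R * smooth d (deficiency R d) 0 (m + del).

Lemma target_deficiencyE : target_deficiency =
  \sum_(k < d) weight k * smooth d (deficiency R d) k del.
Proof.
rewrite /target_deficiency addrC (smoothD (deficiency_test R d)) mulr_sumr.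
by apply: eq_bigr => k _; rewrite mulrA add0n.
Qed.

Lemma target_deficiency_ge : (1 - del) * L <= target_deficiency.
Proof.
rewrite target_deficiencyE mulr_sumr; apply: ler_sum => k _.
rewrite mulrA [leLHS]mulrC ler_wpM2l ?weight_ge0//.
by apply: smooth_deficiency_ge => //; exact: ltW delay_gt0.
Qed.

Lemma target_deficiency_le : target_deficiency <= L - (1 - expR (- del)) * (L / d%:R).
Proof.
have d0 : 0 < d%:R :> R by have := (d_ge2 R d2); lra.
rewrite target_deficiencyE; apply: (@le_trans _ _
    (L - (1 - expR (- del)) * \sum_(k < d) weight k)).
  rewrite /total_deficiency mulr_sumr -sumrB; apply: ler_sum => k _.
  rewrite [(d - k)%:R * _]mulrC [_ * weight k]mulrC -mulrBr ler_wpM2l ?weight_ge0//.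
  by apply: smooth_deficiency_le => //; exact: ltW delay_gt0.
rewrite lerD2l lerN2 ler_wpM2l//.
  by rewrite subr_ge0 expR_le1 oppr_le0 ltW ?delay_gt0.
rewrite ler_pdivrMr// mulr_suml; apply: ler_sum => k _.
by rewrite [leRHS]mulrC ler_wpM2r ?weight_ge0// ler_nat leq_subr.
Qed.

(** With the clock nearly at zero the statistic is close to the true deficiency,
    which up to step [s] is at least [L]; but its target at time [m + delay] is lower
    than [L] by at least [delay * L / (2 * d)]. *)
Lemma expired_deviation (G : graph n) r : admissible d G -> (#|G| <= s)%N ->
    0 <= r < tick R d G -> 8 * d%:R ^+ 2 <= del * L ->
  del * L / (4 * d%:R) <= `|stat d (deficiency R d) G r - target_deficiency|.
Proof.
move=> Gadm Gs /andP[r0 rt] big; have d2' := d_ge2 R d2.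
apply: le_trans (ler_norm _).
have sg := stat_deficiency_ge d2 Gadm r0.
have Ll : L <= d%:R * n%:R - 2 * #|G|%:R.
  by rewrite -sL lerD2l lerN2 ler_wpM2l// ler_nat.
have L1 := total_ge1.
have dU : d%:R * n%:R - 2 * #|G|%:R <= d%:R * #|unsat d G|%:R :> R.
  by rewrite lerBlDr -!natrM -natrD ler_nat; exact: deficiency_le_unsat.
have U0 : 0 < #|unsat d G|%:R :> R.
  have : 0 < d%:R * #|unsat d G|%:R :> R by lra.
  by rewrite pmulr_rgt0//; lra.
have rU : r * (d%:R * n%:R - 2 * #|G|%:R) <= 2 * d%:R.
  apply: (@le_trans _ _ (r * (d%:R * #|unsat d G|%:R))); first by rewrite ler_wpM2l.
  have : r * #|unsat d G|%:R <= 2.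
    by move: rt; rewrite /tick ltr_pdivlMr// => /ltW.
  nra.
have tl := target_deficiency_le.
have hd : del / 2 <= 1 - expR (- del).
  by apply: expRN_le_half; rewrite ltW ?delay_gt0//=; have := delay_le1; lra.
have Ld : del / 2 * (L / d%:R) <= (1 - expR (- del)) * (L / d%:R).
  by rewrite ler_wpM2r// divr_ge0//; lra.
have e4 : del / 2 * (L / d%:R) = 2 * (del * L / (4 * d%:R)).
  by field; rewrite gt_eqF//; lra.
have : 2 * d%:R <= del * L / (4 * d%:R).
  rewrite ler_pdivlMr; last by lra.
  by have -> : 2 * d%:R * (4 * d%:R) = 8 * d%:R ^+ 2 :> R by ring.
lra.
Qed.

(** At step [s] the true deficiency is [L], and each unit of time left lowers the
    expected deficiency by a fixed proportion of [L]; the target is lower than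
    [L] by at most [delay * L]. *)
Lemma remaining_time (G : graph n) r : admissible d G -> #|G| = s -> 0 <= r ->
    `|stat d (deficiency R d) G r - target_deficiency| < del * L / (4 * d%:R) ->
  r <= 4 * d%:R * del.
Proof.
move=> Gadm Gs r0 /ltW; rewrite ler_norml => /andP[hl _]; have d2' := d_ge2 R d2.
have d0 : 0 < d%:R :> R by lra.
have sl := stat_deficiency_le d2 Gadm r0; rewrite Gs sL in sl.
have dU : L <= d%:R * #|unsat d G|%:R.
  by rewrite -sL -Gs lerBlDr -!natrM -natrD ler_nat; exact: deficiency_le_unsat.
have tg := target_deficiency_ge; have L1 := total_ge1.
have e0 : 0 <= 1 - expR (- r) by rewrite subr_ge0 expR_le1 oppr_le0.
have dg := delay_gt0; have e3 := delay_le_slack; have e4 := slack_le.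
have e5 : del * L / (4 * d%:R) <= del * L.
  have dL : 0 <= del * L by apply: mulr_ge0; lra.
  have d4 : 0 < 4 * d%:R :> R by lra.
  by rewrite ler_pdivrMr// ler_peMr//; lra.
have h1 : (1 - expR (- r)) * #|unsat d G|%:R <= 2 * del * L by lra.
have h2 : (1 - expR (- r)) * L <= 2 * d%:R * del * L.
  apply: (@le_trans _ _ ((1 - expR (- r)) * (d%:R * #|unsat d G|%:R))).
    by rewrite ler_wpM2l.
  have : d%:R * ((1 - expR (- r)) * #|unsat d G|%:R) <= d%:R * (2 * del * L).
    by rewrite ler_wpM2l// ltW.
  lra.
have -> : 4 * d%:R * del = 2 * (2 * d%:R * del) by ring.
apply: le_double_of_expRN => //; last by move: h2; rewrite ler_pM2r//; lra.
have e6 : d%:R * del <= d%:R * eps by rewrite ler_wpM2l// ltW.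
have := mulr_gt0 d0 dg; lra.
Qed.

(** The statistic of degree [j] counts the vertices that now have degree [j], up
    to a factor [expR (- r)], and those of a lower degree [k] with the small
    weight [poisson (j - k) r].  The latter are controlled through their own
    statistics, whose thresholds are of the order of [w * sqrt (weight k)]: the
    weights [weight k] may be much larger than [q], but then [m] is small and so
    is [r]. *)
Lemma num_degree_near (G : graph n) r : 0 <= r -> r <= 4 * d%:R * del ->
    (forall k : 'I_j.+1, `|stat d (at_degree R k) G r - n%:R * poisson k (m + del)|
       <= eps * w * Num.sqrt (weight k + 1)) ->
  `|(num_degree j G)%:R - q| <= w * rt.
Proof.
move=> r0 rdel near_k; have d2' := d_ge2 R d2; have d0 : 0 < d%:R :> R by lra.
have e0 := slack_gt0; have dg := delay_gt0; have de := delay_le_slack.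
have e8 := slack_le; have F1 := fact_ge1R R d; have r1 := sqrt_weight_ge1.
have w0' := ltW w0; have dm := delay_le_m; have q'0 := prev_weight_ge0.
have m0' := ltW m0; have dg' := ltW dg.
set T := w * rt; have T0 : 0 <= T by rewrite mulr_ge0// (le_trans _ r1).
have delT : del * q' <= eps * T.
  have := delay_mul; rewrite mulrDr -mulrA -/T => <-.
  by rewrite lerDr mulr_ge0// weight_ge0.
have delqT : del * q <= eps * T.
  by have := delay_mul; rewrite mulrDr -mulrA -/T => <-; rewrite lerDl mulr_ge0.
have rhalf : r <= 1 / 2.
  apply: le_trans rdel _; have : d%:R * del <= d%:R * eps by rewrite ler_wpM2l// ltW.
  lra.
have expr2 : expR r <= 1 + 2 * r by apply: expR_sub1_le; rewrite r0.
have expr1 : 1 <= expR r by rewrite -[leLHS]expR0 ler_expR.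
have Q1 : 1 <= Q by rewrite exprn_ege1//; lra.
have n0 : 0 <= n%:R :> R by [].
have rQ l : (l <= d)%N -> r ^+ l <= Q * del ^+ l.
  move=> ld; apply: (@le_trans _ _ ((4 * d%:R * del) ^+ l)).
    by rewrite lerXn2r ?nnegrE//; apply: mulr_ge0.
  rewrite exprMn ler_wpM2r ?exprn_ge0//.
  by rewrite ler_weXn2l//; lra.
have term (k : 'I_j) : (num_degree k G)%:R * poisson (j - k) r
    <= (2 ^+ d.+1 + 4) * Q * F * (eps * T).
  have kj := ltn_ord k; have j0 : (0 < j)%N by rewrite (leq_ltn_trans _ kj).
  have kd : (k < d)%N by rewrite (ltn_trans kj).
  set l := (j - k)%N; have l0 : (0 < l <= j)%N by rewrite subn_gt0 kj leq_subr.
  have kE : (j - l)%N = k by rewrite subKn// ltnW.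
  have := near_k (widen_ord (leqnSn j) k); rewrite ler_norml => /andP[_ /= hk].
  have Dk := num_degree_le G kd r0.
  have dbl : n%:R * poisson k (m + del) <= 2 ^+ d * weight k.
    apply: (@le_trans _ _ (n%:R * (2 ^+ k * poisson k m))).
      by rewrite ler_wpM2l// poisson_double// => _; exact: dm.
    rewrite mulrCA -/(weight k) ler_wpM2r ?weight_ge0//.
    by rewrite ler_weXn2l ?ler1n// ltnW.
  have sq0 := sqrtr_ge0 (weight k + 1).
  have Nk : (num_degree k G)%:R <= 2 * (2 ^+ d * weight k + eps * w * Num.sqrt (weight k + 1)).
    apply: le_trans Dk _; apply: (@le_trans _ _
        (expR r * (2 ^+ d * weight k + eps * w * Num.sqrt (weight k + 1)))).
      by rewrite ler_wpM2l ?expR_ge0//; lra.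
    rewrite ler_wpM2r; [by []| |lra].
    by rewrite addr_ge0 ?mulr_ge0 ?weight_ge0 ?exprn_ge0 ?(ltW e0).
  have pr : poisson l r <= Q * del ^+ l.
    apply: le_trans (poisson_le_exp _ r0) _; apply: rQ.
    by rewrite (leq_trans _ (ltnW jd))// leq_subr.
  have s1 : weight k * del ^+ l <= F * (eps * T).
    have := poisson_shortfall l0 (ltnW jd) m0' dg' (dm j0); rewrite kE => h.
    apply: (@le_trans _ _ (n%:R * (F * (del * poisson j.-1 m)))).
      by rewrite /weight -mulrA ler_wpM2l.
    have -> : n%:R * (F * (del * poisson j.-1 m)) = F * (del * weight j.-1).
      by rewrite /weight; ring.
    by rewrite ler_wpM2l//; move: delT; rewrite /prev_weight j0.
  have s2 : Num.sqrt (weight k + 1) * del ^+ l <= 2 * F * rt.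
    have q1' := q1; have del1 : del <= 1 by have := delay_le1; lra.
    have h : weight k * (del ^+ l) ^+ 2 <= F * q.
      have := poisson_shortfall_sqr (leq_subr k j) (ltnW jd) m0' dg' del1 (dm j0).
      rewrite -/l kE => h; rewrite /weight -mulrA [leRHS]mulrCA ler_wpM2l//.
    have dl0 : 0 <= del ^+ l by rewrite exprn_ge0.
    have h2 : (del ^+ l) ^+ 2 <= 1 by rewrite !exprn_ile1// ?exprn_ge0.
    rewrite -ler_sqr ?nnegrE ?mulr_ge0// ?(le_trans _ r1)//.
    rewrite exprMn sqr_sqrtr ?addr_ge0 ?weight_ge0// [leRHS]exprMn sqrt_weight_sqr.
    apply: (@le_trans _ _ (2 * F * q)); first by rewrite mulrDl; nra.
    by rewrite ler_wpM2r ?weight_ge0//; nra.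
  apply: (@le_trans _ _ (2 * (2 ^+ d * weight k + eps * w * Num.sqrt (weight k + 1))
      * (Q * del ^+ l))).
    by apply: ler_pM => //; exact: poisson_ge0.
  have -> : 2 * (2 ^+ d * weight k + eps * w * Num.sqrt (weight k + 1)) * (Q * del ^+ l) =
    Q * (2 ^+ d.+1 * (weight k * del ^+ l)
         + 2 * (eps * w) * (Num.sqrt (weight k + 1) * del ^+ l)) by rewrite exprS; ring.
  have -> : (2 ^+ d.+1 + 4) * Q * F * (eps * T) =
    Q * (2 ^+ d.+1 * (F * (eps * T)) + 2 * (eps * w) * (2 * F * rt)) by rewrite /T; ring.
  rewrite ler_wpM2l ?(le_trans _ Q1)// lerD// ler_wpM2l ?exprn_ge0//.
  by rewrite !mulr_ge0// ltW.
pose Rj := \sum_(k < j) (num_degree k G)%:R * poisson (j - k) r.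
have Rj0 : 0 <= Rj by apply: sumr_ge0 => k _; rewrite mulr_ge0// poisson_ge0.
have c0 : 0 <= (2 ^+ d.+1 + 4) * Q * F * (eps * T).
  by rewrite !mulr_ge0 ?addr_ge0 ?exprn_ge0 ?(ltW e0)// (le_trans _ Q1).
have RjE : Rj <= d%:R * ((2 ^+ d.+1 + 4) * Q * F * (eps * T)).
  apply: (@le_trans _ _ (\sum_(k < j) ((2 ^+ d.+1 + 4) * Q * F * (eps * T)))).
    by apply: ler_sum => k _; exact: term.
  rewrite sumr_const card_ord -[leLHS]mulr_natl ler_wpM2r//.
  by rewrite ler_nat ltnW.
have sj := stat_at_degreeE G r jd; rewrite big_ord_recr /= subnn poisson0 -/Rj in sj.
have := near_k ord_max; rewrite /= sj ler_norml => /andP[yl yu].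
have q1' := q1; have sq1 : Num.sqrt (q + 1) <= 2 * rt.
  rewrite -ler_sqr ?nnegrE ?sqrtr_ge0 ?mulr_ge0 ?(le_trans _ r1)//.
  by rewrite sqr_sqrtr ?addr_ge0 ?weight_ge0// exprMn sqrt_weight_sqr; lra.
have yT : eps * w * Num.sqrt (q + 1) <= 2 * (eps * T).
  apply: (@le_trans _ _ (eps * w * (2 * rt))); last by rewrite /T; lra.
  by rewrite ler_wpM2l// mulr_ge0// ltW.
have tl : q - eps * T <= n%:R * poisson j (m + del).
  have := poissonD_ge j m0' dg' => h.
  have : n%:R * ((1 - del) * poisson j m) <= n%:R * poisson j (m + del) by rewrite ler_wpM2l.
  have -> : n%:R * ((1 - del) * poisson j m) = q - del * q by rewrite /weight; ring.
  lra.
have tu : n%:R * poisson j (m + del) <= q + d%:R * F * (eps * T).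
  have h := poissonD_le jd m0' dg' dm.
  have h2 := ler_wpM2l n0 h; apply: le_trans h2 _.
  rewrite mulrDr -/(weight j) lerD2l.
  have -> : n%:R * (d%:R * F * (del * (if (0 < j)%N then poisson j.-1 m else 0)))
    = d%:R * F * (del * q').
    by rewrite /prev_weight /weight; case: ifP => _; ring.
  by rewrite ler_wpM2l// mulr_ge0// ltW.
have eT0 : 0 <= eps * T by rewrite mulr_ge0// ltW.
have dF : 1 <= d%:R * F by nra.
have near0 : `|(num_degree j G)%:R * expR (- r) - q| <= E1 * (eps * T).
  have eT1 : eps * T <= d%:R * F * (eps * T) by rewrite ler_peMl.
  rewrite /error_const !mulrDl -!mulrA in RjE *.
  rewrite ler_norml; apply/andP; split; lra.
have NE : (num_degree j G)%:R - q =
    expR r * ((num_degree j G)%:R * expR (- r) - q) + (expR r - 1) * q.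
  have : expR r * expR (- r) = 1 by rewrite -expRD subrr expR0.
  by move=> er; rewrite mulrBr mulrCA er; ring.
rewrite NE; apply: le_trans (ler_normD _ _) _.
rewrite [`|expR r * _|]normrM [`|(expR r - 1) * _|]normrM.
rewrite (ger0_norm (expR_ge0 r)) (ger0_norm (weight_ge0 j)) [`|expR r - 1|]ger0_norm ?subr_ge0//.
have h1 : expR r * `|(num_degree j G)%:R * expR (- r) - q| <= 2 * (E1 * (eps * T)).
  by apply: ler_pM => //; lra.
have h2 : (expR r - 1) * q <= 8 * d%:R * (eps * T).
  apply: (@le_trans _ _ (8 * d%:R * del * q)).
    by rewrite ler_wpM2r ?weight_ge0//; lra.
  by rewrite -mulrA ler_wpM2l// mulr_ge0.
have := slackE => sE.
have TE : T = 2 * (E1 * (eps * T)) + 8 * d%:R * (eps * T).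
  transitivity (eps * (2 * E1 + 8 * d%:R) * T); last by ring.
  by rewrite sE mul1r.
rewrite [leRHS]TE; exact: lerD.
Qed.

End Deviations.

(** * The variance of the statistics *)

Section Variance.
Variables (R : realType) (d : nat).
Hypothesis d2 : (2 <= d)%N.

Lemma spread_at_degree_le k u : (k < d)%N -> spread d (at_degree R k) 0 u <= poisson k u.
Proof.
move=> kd; apply: le_trans (spread_le _ _ _ _) _.
have := smooth_at_degree 0 u kd; rewrite leq0n subn0 => <-.
rewrite le_eqVlt; apply/orP; left; apply/eqP; apply: eq_bigr => l _.
by rewrite /at_degree; case: eqP => _; rewrite ?expr1n ?expr0n.
Qed.

Lemma spread_deficiency_le i u : 0 <= u ->
  spread d (deficiency R d) i u <= d%:R * smooth d (deficiency R d) i u.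
Proof.
move=> u0; apply: le_trans (spread_le _ _ _ _) _; rewrite mulr_sumr.
apply: ler_sum => k _; rewrite [leRHS]mulrCA ler_wpM2l ?poisson_ge0// expr2.
have /andP[p0 pd] := (deficiency_test R d).1 (i + k)%N.
by rewrite ler_wpM2r.
Qed.

(** The variance is at most the mean squared distance from [d], and the deficiency
    differs from [d] with probability at most [u] only.  At early times this is
    much better than [spread_deficiency_le]. *)
Lemma spread_deficiency_early u : 0 <= u ->
  spread d (deficiency R d) 0 u <= d%:R ^+ 2 * u.
Proof.
move=> u0; set g := smooth d (deficiency R d) 0 u; rewrite /spread -/g.
apply: (@le_trans _ _ (d%:R ^+ 2 * (1 - expR (- u)))); last first.
  by rewrite ler_wpM2l ?exprn_ge0//; have := expR_ge1Dx (- u); lra.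
have h : smooth d (fun k => deficiency R d k ^+ 2) 0 u - 2 * d%:R * g
    <= - (d%:R ^+ 2 * expR (- u)).
  rewrite /g /smooth mulr_sumr -sumrB.
  rewrite -(big_mkord xpredT (fun k => poisson k u * deficiency R d (0 + k) ^+ 2
    - 2 * d%:R * (poisson k u * deficiency R d (0 + k)))).
  rewrite big_ltn ?(ltn_trans _ d2)// poisson0 -[leRHS]addr0 lerD//.
    by rewrite /deficiency addn0 subn0 le_eqVlt; apply/orP; left; apply/eqP; ring.
  rewrite big_nat; apply: sumr_le0 => k _.
  have /andP[p0 pd] := (deficiency_test R d).1 (0 + k)%N.
  have := poisson_ge0 k u0; set p := poisson k u => pk.
  set f := deficiency R d (0 + k) in p0 pd *.
  have -> : p * f ^+ 2 - 2 * d%:R * (p * f) = - (p * f * (2 * d%:R - f)) by ring.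
  rewrite oppr_le0; apply: mulr_ge0; first exact: mulr_ge0.
  by have := ler0n R d; lra.
by have := sqr_ge0 (g - d%:R); lra.
Qed.

End Variance.

Section Cost.
Variables (R : realType) (d j n : nat) (m w : R).
Hypotheses (d2 : (2 <= d)%N) (jd : (j < d)%N).
Hypotheses (m0 : 0 < m) (w0 : 0 < w) (q1 : 1 <= weight n m j).
Hypothesis wq : w <= Num.sqrt (weight n m j).

Local Notation q := (weight n m j).
Local Notation q' := (prev_weight j n m).
Local Notation L := (total_deficiency d n m).
Local Notation eps := (slack R d).
Local Notation del := (delay d j n m w).
Local Notation V := (n%:R * spread d (deficiency R d) 0 (m + del)).

Lemma target_ge0 : 0 <= m + del.
Proof. by rewrite addr_ge0// ltW// delay_gt0. Qed.

Lemma deficiency_variance_late : V <= d%:R * L.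
Proof.
apply: (@le_trans _ _ (d%:R * target_deficiency d j n m w)).
  rewrite /target_deficiency [leRHS]mulrCA ler_wpM2l//.
  by apply: spread_deficiency_le => //; exact: target_ge0.
rewrite ler_wpM2l//; apply: le_trans (target_deficiency_le d2 m0 w0 q1) _.
have L1 := total_ge1 jd m0 q1; have d0 : 0 < d%:R :> R by rewrite ltr0n (ltn_trans _ d2).
rewrite lerBlDr lerDl mulr_ge0 ?divr_ge0//; last lra.
by rewrite subr_ge0 expR_le1 oppr_le0 ltW// delay_gt0.
Qed.

Lemma deficiency_variance_early : (0 < j)%N -> V <= 2 * n%:R * d%:R ^+ 2 * m.
Proof.
move=> j0; have dm := delay_le_m d2 m0 w0 q1 wq j0.
apply: (@le_trans _ _ (n%:R * (d%:R ^+ 2 * (m + del)))).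
  by rewrite ler_wpM2l// spread_deficiency_early// target_ge0.
have -> : 2 * n%:R * d%:R ^+ 2 * m = n%:R * (d%:R ^+ 2 * (m + m)) by ring.
by rewrite ler_wpM2l// ler_wpM2l ?exprn_ge0// lerD2l.
Qed.

Definition variance_const : R :=
  2 * ((2 * d%:R + 1) + (2 * d%:R + 1) * d%:R + 16 * d%:R ^+ 3 + 1).

Lemma n_le_total : m <= 1 -> n%:R <= 4 * L.
Proof.
move=> m1; have d0 : (0 < d)%N by rewrite (ltn_trans _ d2).
have h0 : weight n m 0 <= L.
  rewrite /total_deficiency (bigD1 (Ordinal d0))//= -[leLHS]addr0 lerD//.
    by rewrite ler_peMl ?weight_ge0// ler1n subn_gt0.
  by apply: sumr_ge0 => k _; rewrite mulr_ge0 ?weight_ge0.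
have h1 : 1 / 4 <= expR (- m).
  have -> : - m = - (m / 2) + - (m / 2) by lra.
  have := expR_ge1Dx (- (m / 2)); rewrite expRD; set e := expR _ => he.
  have he2 : 1 / 2 <= e by lra.
  by have : 1 / 2 * (1 / 2) <= e * e; [rewrite ler_pM//; lra|lra].
rewrite /weight poisson0 in h0.
have : n%:R * (1 / 4) <= n%:R * expR (- m) by rewrite ler_wpM2l.
lra.
Qed.

(** A fluctuation of the deficiency of order [sqrt V] displaces the clock by
    [sqrt V / L], and [weight j] by [(q + q') * sqrt V / L]; this has to be of
    order [sqrt q].  When [m >= 1] the ratio [q' / q] is bounded and [V <= d * L]
    is enough.  When [m < 1] that ratio is of order [1 / m], and it is made up for
    by the factor [m] of the early variance bound. *)
Lemma deficiency_variance :
  (2 * V + 1) * (q + q') ^+ 2 <= variance_const * (q * L ^+ 2).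
Proof.
have L1 := total_ge1 jd m0 q1; have qL := total_ge_pair n jd m0.
have q'0 := prev_weight_ge0 j n m0; have q0 := weight_ge0 n m0 j.
have q1' := q1; have dd : 2 <= d%:R :> R by rewrite ler_nat.
have Vl := deficiency_variance_late.
have V0 : 0 <= V by rewrite mulr_ge0// spread_ge0// target_ge0.
set v := V in Vl V0 *; set Q := q * L ^+ 2.
have Q0 : 0 <= Q by rewrite mulr_ge0 ?exprn_ge0//; lra.
have qLq : q * (q * L) <= Q by rewrite /Q expr2 ler_wpM2l// ler_wpM2r//; lra.
have lin : 2 * v + 1 <= (2 * d%:R + 1) * L by nra.
have part1 : (2 * v + 1) * q ^+ 2 <= (2 * d%:R + 1) * Q.
  apply: (@le_trans _ _ ((2 * d%:R + 1) * L * q ^+ 2)).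
    by rewrite ler_wpM2r ?exprn_ge0.
  have -> : (2 * d%:R + 1) * L * q ^+ 2 = (2 * d%:R + 1) * (q * (q * L)) by ring.
  by rewrite ler_wpM2l//; lra.
have q'L : q' <= L by lra.
have qq'L : q * q' * L <= Q.
  by rewrite /Q expr2 -mulrA ler_wpM2l// ler_wpM2r//; lra.
have part2 : (2 * v + 1) * q' ^+ 2
    <= ((2 * d%:R + 1) * d%:R + 16 * d%:R ^+ 3 + 1) * Q.
  have c0 : 0 <= (2 * d%:R + 1) * d%:R * Q.
    by apply: mulr_ge0 => //; apply: mulr_ge0; lra.
  have c1 : 0 <= 16 * d%:R ^+ 3 * Q.
    by apply: mulr_ge0 => //; apply: mulr_ge0 => //; exact: exprn_ge0.
  case: (posnP j) => j0.
    have -> : q' = 0 by rewrite /prev_weight j0.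
    by rewrite expr0n mulr0; lra.
  have pq : q' * m <= d%:R * q.
    rewrite /prev_weight j0 weight_pred// ler_wpM2r//.
    by rewrite ler_nat ltnW.
  have [m1|/ltW m1] := leP 1 m.
    have q'q : q' <= d%:R * q by apply: le_trans pq; rewrite ler_peMr.
    have h : q' ^+ 2 * L <= d%:R * Q.
      apply: (@le_trans _ _ (d%:R * (q * q' * L))); last by rewrite ler_wpM2l.
      have -> : d%:R * (q * q' * L) = (d%:R * q * q') * L by ring.
      by rewrite ler_wpM2r; [|lra|rewrite expr2 ler_wpM2r].
    have h2 : (2 * v + 1) * q' ^+ 2 <= (2 * d%:R + 1) * (d%:R * Q).
      apply: (@le_trans _ _ ((2 * d%:R + 1) * L * q' ^+ 2)).
        by rewrite ler_wpM2r ?exprn_ge0.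
      have -> : (2 * d%:R + 1) * L * q' ^+ 2 = (2 * d%:R + 1) * (q' ^+ 2 * L) by ring.
      by rewrite ler_wpM2l//; lra.
    lra.
  have nL := n_le_total m1.
  have Ve := deficiency_variance_early j0; rewrite -/v in Ve.
  have h : 2 * v * q' ^+ 2 <= 16 * d%:R ^+ 3 * Q.
    apply: (@le_trans _ _ (2 * (2 * n%:R * d%:R ^+ 2 * m) * q' ^+ 2)).
      by rewrite ler_wpM2r ?exprn_ge0// ler_wpM2l.
    have -> : 2 * (2 * n%:R * d%:R ^+ 2 * m) * q' ^+ 2 =
      4 * d%:R ^+ 2 * (n%:R * ((q' * m) * q')) by ring.
    have -> : 16 * d%:R ^+ 3 * Q = 4 * d%:R ^+ 2 * (4 * (d%:R * Q)) by ring.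
    rewrite ler_wpM2l ?mulr_ge0 ?exprn_ge0//.
    apply: (@le_trans _ _ ((4 * L) * ((d%:R * q) * q'))).
      apply: ler_pM => //; first by rewrite !mulr_ge0// ltW.
      by rewrite ler_wpM2r.
    have -> : 4 * L * (d%:R * q * q') = 4 * (d%:R * (q * q' * L)) by ring.
    by rewrite ler_wpM2l// ler_wpM2l.
  have h2 : q' ^+ 2 <= Q.
    apply: (@le_trans _ _ (1 * L ^+ 2)); last by rewrite /Q ler_wpM2r// exprn_ge0//; lra.
    by rewrite mul1r lerXn2r ?nnegrE//; lra.
  lra.
apply: (@le_trans _ _ ((2 * v + 1) * (2 * q ^+ 2 + 2 * q' ^+ 2))).
  by rewrite ler_wpM2l; [|lra|have := sqr_ge0 (q - q'); lra].
rewrite /variance_const; lra.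
Qed.

Definition threshold (i : option 'I_j.+1) : R :=
  if i is Some k then eps * w * Num.sqrt (weight n m k + 1)
  else del * L / (4 * d%:R).

Definition test_of (i : option 'I_j.+1) : nat -> R :=
  if i is Some k then at_degree R k else deficiency R d.

Lemma threshold_gt0 i : 0 < threshold i.
Proof.
have e0 := slack_gt0 R d2; have L1 := total_ge1 jd m0 q1.
have dg := delay_gt0 d2 m0 w0 q1.
case: i => [k|] /=; last first.
  have d0 : 0 < d%:R :> R by rewrite ltr0n (ltn_trans _ d2).
  by apply: divr_gt0; apply: mulr_gt0 => //; lra.
by rewrite !mulr_gt0// sqrtr_gt0 ltr_wpDl ?weight_ge0.
Qed.

Definition cost_const : R := 16 * d%:R ^+ 2 * variance_const + 2 ^+ d.+1.

(** Each term of Chebyshev's inequality is [O(w ^- 2)].  The added one in the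
    thresholds of degree [k] is there for weights smaller than one. *)
Lemma cost_le i : (threshold i)^-1 ^+ 2 *
    (2 * (n%:R * spread d (test_of i) 0 (m + del)) + 1)
  <= cost_const / (eps * w) ^+ 2.
Proof.
have ew0 : 0 < (eps * w) ^+ 2 by rewrite exprn_gt0// mulr_gt0// slack_gt0.
have d0 : 0 < d%:R :> R by rewrite ltr0n (ltn_trans _ d2).
have vc0 : 0 <= variance_const.
  by rewrite mulr_ge0 ?addr_ge0 ?mulr_ge0 ?addr_ge0 ?mulr_ge0 ?exprn_ge0.
rewrite exprVn mulrC ler_pdivrMr ?exprn_gt0 ?threshold_gt0//.
rewrite mulrAC ler_pdivlMr//; case: i => [k|] /=.
  have kd : (k < d)%N by rewrite (leq_trans (ltn_ord k)).
  have wk := weight_ge0 n m0 k.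
  rewrite [(_ * Num.sqrt _) ^+ 2]exprMn sqr_sqrtr ?addr_ge0// [leRHS]mulrCA [leLHS]mulrC.
  rewrite ler_wpM2l ?(ltW ew0)//.
  have sp : n%:R * spread d (at_degree R k) 0 (m + del) <= 2 ^+ d * weight n m k.
    apply: (@le_trans _ _ (n%:R * poisson k (m + del))).
      by rewrite ler_wpM2l// spread_at_degree_le.
    apply: (@le_trans _ _ (n%:R * (2 ^+ k * poisson k m))).
      rewrite ler_wpM2l// poisson_double// ?(ltW m0)//.
        exact/ltW/delay_gt0.
      move=> k0; apply: delay_le_m => //.
      by rewrite (leq_trans k0)// -ltnS ltn_ord.
    rewrite mulrCA -/(weight n m k) ler_wpM2r//.
    by rewrite ler_weXn2l ?ler1n// ltnW.
  apply: (@le_trans _ _ (2 ^+ d.+1 * (weight n m k + 1))).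
    have p1 : 1 <= 2 ^+ d :> R by rewrite exprn_ege1// ler1n.
    have -> : 2 ^+ d.+1 * (weight n m k + 1) = 2 * (2 ^+ d * weight n m k) + 2 * 2 ^+ d.
      by rewrite exprS; ring.
    lra.
  rewrite ler_wpM2r ?addr_ge0// lerDr.
  by rewrite mulr_ge0// mulr_ge0 ?exprn_ge0.
have dv := deficiency_variance.
have qq : 0 < (q + q') ^+ 2 by rewrite exprn_gt0// denom_gt0.
have dE : (del * (q + q')) ^+ 2 = (eps * w) ^+ 2 * q.
  by rewrite delay_mul// exprMn sqrt_weight_sqr.
apply: (@le_trans _ _ (variance_const * (del * L) ^+ 2)); last first.
  rewrite expr_div_n [leRHS]mulrA ler_pdivlMr; last by rewrite exprn_gt0// mulr_gt0.
  rewrite [leLHS]mulrAC ler_wpM2r ?sqr_ge0//.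
  rewrite /cost_const exprMn.
  have -> : variance_const * (4 ^+ 2 * d%:R ^+ 2) = 16 * d%:R ^+ 2 * variance_const by ring.
  by rewrite lerDl exprn_ge0.
rewrite -(ler_pM2r qq).
have -> : variance_const * (del * L) ^+ 2 * (q + q') ^+ 2 =
   (eps * w) ^+ 2 * (variance_const * (q * L ^+ 2)).
  transitivity (variance_const * ((del * (q + q')) ^+ 2 * L ^+ 2)); first by ring.
  by rewrite dE; ring.
by rewrite mulrAC mulrC ler_wpM2l ?(ltW ew0).
Qed.

End Cost.

(** * Concentration *)

Section Concentration.
Variables (R : realType) (d j : nat).
Hypotheses (d2 : (2 <= d)%N) (jd : (j < d)%N).

Lemma test_of_test (i : option 'I_j.+1) : test_fun d d%:R (test_of R d i).
Proof.
case: i => [k|]; last exact: deficiency_test.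
by apply: at_degree_test => //; rewrite (leq_trans (ltn_ord k)).
Qed.

(** The statement for a single [n].  The lower bound on [w] makes the deficiency
    at step [s] at least [8 * d ^ 2], so that the process does not stop early. *)
Lemma prob_num_degree : exists2 C : R, 0 <= C & forall (n s : nat) (m w : R),
    0 < m -> 1 <= weight n m j -> 0 < w -> w <= Num.sqrt (weight n m j) ->
    d%:R * n%:R - 2 * s%:R = total_deficiency d n m ->
    8 * d%:R ^+ 2 <= slack R d * w ->
  `|prob_G R d s (fun G : graph n => `|(num_degree j G)%:R - weight n m j|
      <= w * Num.sqrt (weight n m j)) - 1| <= C * w ^- 2.
Proof.
have [C C0 HC] := prob_bad_le R d2.
pose N : R := #|{: option 'I_j.+1}|%:R.
have cc0 : 0 <= cost_const R d.
  by rewrite addr_ge0 ?exprn_ge0// mulr_ge0 ?mulr_ge0 ?exprn_ge0// mulr_ge0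
    ?addr_ge0 ?mulr_ge0 ?addr_ge0 ?exprn_ge0 ?mulr_ge0.
exists (C * (N * (cost_const R d / slack R d ^+ 2))).
  by rewrite mulr_ge0// mulr_ge0// divr_ge0// exprn_ge0// ltW// slack_gt0.
move=> n s m w m0 q1 w0 wq sL big.
pose del := delay d j n m w; pose L := total_deficiency d n m.
have dg : 0 < del := delay_gt0 d2 m0 w0 q1.
have dtot := delay_total d2 jd m0 w0 q1.
have bigL : 8 * d%:R ^+ 2 <= del * L by exact: le_trans dtot.
have L1 : 1 <= L := total_ge1 jd m0 q1.
have del1 : del <= 1 / 16 := delay_le1 d2 m0 q1 wq.
have ns : (2 * s + 2 * d * d <= d * n)%N.
  rewrite -(ler_nat R) natrD !natrM.
  have : del * L <= 1 * L by rewrite ler_wpM2r; lra.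
  by move: bigL; rewrite expr2 -/L in sL *; have := sqr_ge0 (d%:R : R); rewrite expr2; lra.
pose A (G : graph n) := `|(num_degree j G)%:R - weight n m j| <= w * Num.sqrt (weight n m j).
pose bad (G : graph n) := ~~ ((#|G| == s) && A G).
pose P := iter s (@step_exp R d n) (fun G => (bad G)%:R) finset.set0.
rewrite (_ : prob_G _ _ _ _ = 1 - P); last exact: prob_GE.
have u00 : 0 <= m + del by rewrite addr_ge0 ?(ltW m0) ?(ltW dg).
have P0 : 0 <= P.
  rewrite -(iter_step_exp_cst d 0 s (finset.set0 : graph n)).
  by apply: iter_step_exp_le => G; case: (bad G).
have -> : `|1 - P - 1| = P by rewrite addrAC subrr sub0r normrN ger0_norm.
pose thr := @threshold R d j n m w.
have thr0 i : 0 < thr i by exact: threshold_gt0.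
have thrP i (y : R) : (1 <= (thr i)^-1 ^+ 2 * y ^+ 2) = (thr i <= `|y|).
  rewrite -exprMn mulrC -[(y / _) ^+ 2]real_normK ?num_real//.
  rewrite normrM [`|(thr i)^-1|]gtr0_norm ?invr_gt0//.
  have h0 : 0 <= `|y| / thr i by rewrite divr_ge0// ltW.
  rewrite -[X in X <= _](expr1n _ 2) ler_sqr ?nnegrE//.
  by rewrite ler_pdivlMr// mul1r.
have := HC n s (option 'I_j.+1) (@test_of R d j) (fun i => (thr i)^-1 ^+ 2) (m + del) bad.
rewrite -/P => /(_ test_of_test _ u00 ns) HP.
apply: le_trans (HP _ _) _.
- by move=> i; exact: sqr_ge0.
- move=> G u Gadm Gs /andP[u0 _] cases.
  have x0E (i : option 'I_j.+1) : stat d (test_of R d i) (finset.set0 : graph n) (m + del) =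
      if i is Some k then n%:R * poisson k (m + del) else target_deficiency d j n m w.
    rewrite stat_empty; case: i => [k|]; last by [].
    have kd : (k < d)%N := leq_trans (ltn_ord k) jd.
    by rewrite /= smooth_at_degree// leq0n subn0.
  case: cases => [ut|[Gs' badG]].
    exists None; rewrite thrP x0E.
    by apply: (expired_deviation d2 jd m0 w0 q1 wq sL Gadm Gs) => //; rewrite u0.
  apply: contrapT => no.
  have near_i (i : option 'I_j.+1) : `|stat d (test_of R d i) G u -
      stat d (test_of R d i) (finset.set0 : graph n) (m + del)| < thr i.
    by rewrite ltNge -thrP; apply/negP => h; apply: no; exists i.
  have := near_i None; rewrite x0E => /= nL.
  have ur := remaining_time d2 jd m0 w0 q1 wq sL Gadm Gs' u0 nL.
  suff : `|(num_degree j G)%:R - weight n m j| <= w * Num.sqrt (weight n m j).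
    by move=> h; move: badG; rewrite /bad /A Gs' eqxx h.
  apply: (num_degree_near d2 jd m0 w0 q1 wq u0 ur) => k.
  by have := near_i (Some k); rewrite x0E => /ltW.
rewrite -[leRHS]mulrA ler_wpM2l//.
apply: (@le_trans _ _ (\sum_(i : option 'I_j.+1) cost_const R d / (slack R d * w) ^+ 2)).
  apply: ler_sum => i _; rewrite stat_spread_empty.
  exact: (cost_le d2 jd m0 w0 q1 wq).
rewrite sumr_const -[leLHS]mulr_natl -/N -[leRHS]mulrA ler_wpM2l//.
by rewrite exprMn invfM mulrA.
Qed.

End Concentration.

(* The conditions on s and x are required for large n only: for n = 0, and for
   n = 1 with d = 2, they cannot be met.  That x n is the inverse image of s n
   under the injective function ell d n on the positive reals is [hx]. *)
Theorem theorem1p4 (R : realType) (d j : nat) (hd : (2 <= d)%N)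
    (hj : (j <= d - 1)%N) (s : nat -> nat) (x w : nat -> R)
    (hs : \forall n \near \oo, (1 <= s n)%N /\ (s n)%:R <= d%:R * n%:R / 2 :> R)
    (hx : \forall n \near \oo, 0 < x n /\ ell d n (x n) = (s n)%:R)
    (hbeta : beta j n (x n) @[n --> \oo] --> +oo)
    (hw : w n @[n --> \oo] --> +oo)
    (hwo : w =o_\oo (fun n => Num.sqrt (beta j n (x n)))) :
  (fun n => prob_G R d (s n) (fun G : graph n =>
     `|(num_degree j G)%:R - beta j n (x n)|
       <= w n * Num.sqrt (beta j n (x n))))
  = cst 1 +O_\oo (fun n => w n ^- 2).
Proof.
have jd : (j < d)%N by rewrite (leq_ltn_trans hj)// subn1 ltn_predL (ltn_trans _ hd).
have [C C0 HC] := prob_num_degree R hd jd.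
have betaE k n y : beta k n y = weight n (y / n%:R) k :> R.
  by rewrite /beta /weight /poisson !mulrA.
apply/eqaddOP; near=> K; near=> n.
have KC : C <= K by near: K; apply: nbhs_pinfty_ge; exact: num_real.
have [x0 xE] : 0 < x n /\ ell d n (x n) = (s n)%:R by near: n.
have n0 : 0 < n%:R :> R by rewrite ltr0n; near: n; exact: nbhs_infty_gt.
have b1 : 1 <= beta j n (x n).
  by near: n; move/cvgryPge : hbeta; exact.
have wbig : 8 * d%:R ^+ 2 / slack R d <= w n by near: n; move/cvgryPge : hw; exact.
have w1 : 0 < w n by near: n; move/cvgryPgt : hw; exact.
have wle : `|w n| <= 1 * `|Num.sqrt (beta j n (x n))|.
  by near: n; move/eqoP : hwo => /(_ 1 ltr01).
have m0 : 0 < x n / n%:R by rewrite divr_gt0.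
change (`|prob_G R d (s n) (fun G : graph n =>
    `|(num_degree j G)%:R - beta j n (x n)| <= w n * Num.sqrt (beta j n (x n))) - 1|
  <= K * `|w n ^- 2|).
rewrite !betaE in b1 wle *.
have wq : w n <= Num.sqrt (weight n (x n / n%:R) j).
  by move: wle; rewrite mul1r gtr0_norm// ger0_norm ?sqrtr_ge0.
have sL : d%:R * n%:R - 2 * (s n)%:R = total_deficiency d n (x n / n%:R).
  rewrite -xE /ell big_mkord /total_deficiency.
  under eq_bigr do rewrite betaE.
  by field.
have big : 8 * d%:R ^+ 2 <= slack R d * w n.
  by rewrite [leRHS]mulrC -ler_pdivrMr// slack_gt0.
apply: le_trans (HC n (s n) (x n / n%:R) (w n) m0 b1 w1 wq sL big) _.
by rewrite ger0_norm ?invr_ge0 ?exprn_ge0 ?(ltW w1)// ler_wpM2r// invr_ge0 exprn_ge0// ltW.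
Unshelve. all: by end_near. Qed.
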